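(* Consider the nonlinear parameter-varying system $\dot x = A(x,\theta)x + B(x,\theta)u$ with $x(t)\in\mathbb{R}^n$, $u(t)\in\mathbb{R}^m$, $\theta(t)\in\mathbb{R}^{n_\theta}$, where $A(x,\theta)\in\mathbb{R}^{n\times n}$ and $B(x,\theta)\in\mathbb{R}^{n\times m}$ are polynomial matrices and the parameter satisfies $\theta(t)\in\Theta$, $\dot\theta(t)\in\mathcal{V}$ for all $t\ge 0$. Let $\mathcal{X}=\{x\in\mathbb{R}^n: c_j(x)\ge 0,\ j=1,\dots,n\}$ with $c_j(x)=1-x^TC_j(x)^TC_j(x)x$. Suppose there exist polynomial matrices $X(\tilde x,\theta)$ (symmetric, $n\times n$) and $Y(x,\theta)$ ($m\times n$), constants $\varepsilon_1,\varepsilon_2,\varepsilon_3>0$, and SOS polynomials $\lambda_i^l$ ($1\le i\le N_\theta$, $l=1,2,3$), $\alpha_i^j$ ($1\le i\le N_\theta$, $1\le j\le n$), $\mu_j^p$ ($1\le j\le n$, $p=1,2,3$) and $\xi_k$ ($1\le k\le n_\theta$), each a polynomial in the variables of the condition in which it appears, such that $$v_1^T\left(X(\tilde x,\theta)-\varepsilon_1 I\right)v_1-\sum_{i=1}^{N_\theta}\lambda_i^1h_i(\theta)-\sum_{j=1}^n\mu_j^1c_j(x)\ \text{ is SOS in }(x,\theta,v_1),$$ $$v_1^T\left(\varepsilon_2 I-X(\tilde x,\theta)\right)v_1-\sum_{i=1}^{N_\theta}\lambda_i^2h_i(\theta)-\sum_{j=1}^n\mu_j^2c_j(x)\ \text{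 is SOS in }(x,\theta,v_1),$$ $$-v_1^T\left(F_1(x,\theta,\dot\theta)+\varepsilon_3I\right)v_1-\sum_{i=1}^{N_\theta}\lambda_i^3h_i(\theta)-\sum_{j=1}^n\mu_j^3c_j(x)-\sum_{k=1}^{n_\theta}\xi_k(\dot\theta_k-\underline v_k)(\bar v_k-\dot\theta_k)\ \text{ is SOS in }(x,\theta,\dot\theta,v_1),$$ $$v_2^T\begin{bmatrix}1& C_j(x)X(\tilde x,\theta)\\ (C_j(x)X(\tilde x,\theta))^T& X(\tilde x,\theta)\end{bmatrix}v_2-\sum_{i=1}^{N_\theta}\alpha_i^jh_i(\theta)\ \text{ is SOS in }(x,\theta,v_2),\quad j=1,\dots,n,$$ where $v_1\in\mathbb{R}^n$, $v_2\in\mathbb{R}^{n+1}$, $\dot\theta\in\mathbb{R}^{n_\theta}$ are treated as independent indeterminates and $$F_1(x,\theta,\dot\theta)=(AX+BY)+(AX+BY)^T-\sum_{j\in J}\frac{\partial X}{\partial x_j}(A_jx)-\sum_{k=1}^{n_\theta}\frac{\partial X}{\partial\theta_k}\dot\theta_k .$$ Then: (a) The controller $u(x,\theta)=Y(x,\theta)X^{-1}(\tilde x,\theta)x$ renders the origin of the closed-loop system (locally) exponentially stable for all admissible trajectories of $\theta$ (those with $\theta(t)\in\Theta$, $\dot\theta(t)\in\mathcal{V}$ for all $t\ge0$). Moreover, $V(x,\theta)=x^TX^{-1}(\tilde x,\theta)x$ is a parameter-dependent Lyapunov function certifying this stability. (b) The set $\Omega(V,1)=\{(x,\theta)\in\mathbb{R}^n\times\mathbb{R}^{n_\theta}: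 V(x,\theta)\le1,\ \theta\in\Theta\}$ is a subset of a parameter-dependent region of attraction; that is, for every $(x(0),\theta(0))\in\Omega(V,1)$, the closed-loop solution under this controller satisfies $\lim_{t\to\infty}x(t)=0$ for all admissible trajectories of $\theta$.
   Context: A polynomial is SOS (sum of squares) in given variables if it is a finite sum of squares of real polynomials in those variables. Parameter sets: $\Theta=\{\theta\in\mathbb{R}^{n_\theta}: h_i(\theta)\ge0,\ i=1,\dots,N_\theta\}$ with $h_i$ polynomials; $\mathcal{V}=\{v\in\mathbb{R}^{n_\theta}:\underline v_k\le v_k\le\bar v_k,\ k=1,\dots,n_\theta\}$ is a hyper-rectangle. An admissible trajectory of $\theta$ is a (differentiable) function $\theta:[0,\infty)\to\mathbb{R}^{n_\theta}$ with $\theta(t)\in\Theta$ and $\dot\theta(t)\in\mathcal{V}$ for all $t\ge0$. Each $C_j:\mathbb{R}^n\to\mathbb{R}^{1\times n}$ is a row-vector-valued polynomial function, so $\mathcal{X}=\{x: |C_j(x)x|\le1,\ j=1,\dots,n\}$. $A_j(x,\theta)$ denotes the $j$-th row of $A(x,\theta)$. $J$ is the set of indices of rows of $B(x,\theta)$ that are identically zero, and $\tilde x$ is the vector of the components $x_j$, $j\in J$ (the states whose derivatives are not directly affected by the control); $X$ depends on $x$ only through $\tilde x$. The matrix $X^{-1}$, hence $u$ and $V$, is considered where $X(\tilde x,\theta)$ is invertible (the hypotheses give $X\ge\varepsilon_1 I$ for $x\in\mathcal{X}$, $\theta\in\Theta$). Exponential stability of the origin means: there exist constants $k,\gamma,c>0$,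 independent of $t_0$, with $\|x(t)\|\le k\|x(t_0)\|e^{-\gamma(t-t_0)}$ for all $t\ge t_0\ge0$ whenever $\|x(t_0)\|<c$. ''Parameter-dependent Lyapunov function certifying this stability'' means that there are constants $a_1,a_2,a_3>0$ such that for all $x\in\mathcal{X}$ and admissible $\theta$: $a_1\|x\|^2\le V(x,\theta)\le a_2\|x\|^2$ and $\dot V\le -a_3\|x\|^2$ along the closed loop. *)

(* Defs.v *)
(* MathComp-Analysis, over an arbitrary [R : realType]. *)
From mathcomp Require Import all_boot all_order all_algebra.
From mathcomp Require Import -(notations) mpoly.
From mathcomp Require Import all_classical all_reals all_analysis.

Set Implicit Arguments.
Unset Strict Implicit.
Unset Printing Implicit Defensive.

Import Order.TTheory GRing.Theory Num.Theory.
Import numFieldNormedType.Exports.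

Local Open Scope classical_set_scope.
Local Open Scope ring_scope.

(* Variable layout. All polynomials live in rings [mpoly k R] whose variables
   are grouped in consecutive blocks:
     mpoly n                  x
     mpoly nt                 theta
     mpoly (n + nt)           (x, theta)
     mpoly (n + nt + nt)      (x, theta, theta')
     mpoly (n + nt + n)       (x, theta, v1)
     mpoly (n + nt + nt + n)  (x, theta, theta', v1)
     mpoly (n + nt + (1 + n)) (x, theta, v2).
   A polynomial is moved to a larger ring by renaming its variables. *)

Section Polynomials.
Context {R : realType}.

Definition pvar k (i : 'I_k) : mpoly k R := mpolyX R (mnm1 i).

Definition rename k l (f : 'I_k -> 'I_l) (p : mpoly k R) : mpoly l R :=
  comp_mpoly [tuple pvar (f i) | i < k] p.

(* Embeddings as the first, resp. last, block of variables. *)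
Definition embL k l (p : mpoly k R) : mpoly (k + l) R := rename (@lshift k l) p.
Definition embR k l (p : mpoly l R) : mpoly (k + l) R := rename (@rshift k l) p.

Arguments embL {k} l p.
Arguments embR k {l} p.

Definition is_sos k (p : mpoly k R) : Prop :=
  exists s : seq (mpoly k R), p = \sum_(q <- s) q ^+ 2.

Definition qform k p (M : 'M[mpoly k R]_p) (v : 'cV[mpoly k R]_p) : mpoly k R :=
  (v^T *m M *m v) 0 0.

Definition peval k (z : 'cV[R]_k) (p : mpoly k R) : R := meval (fun i => z i 0) p.

Definition mxeval k (z : 'cV[R]_k) p q (M : 'M[mpoly k R]_(p, q)) : 'M[R]_(p, q) :=
  map_mx (peval z) M.

End Polynomials.

Section ParameterVaryingSystem.
Context {R : realType} {n m nt : nat}.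

(* The index set J of the identically zero rows of B. *)
Definition zero_rows (B : 'M[mpoly (n + nt) R]_(n, m)) : {set 'I_n} :=
  [set j | row j B == 0]%SET.

Section ReducedState.
Variable J : {set 'I_n}.

Definition reduced_state (x : 'cV[R]_n) : 'cV[R]_#|J| :=
  \col_i x (enum_val i) 0.

Definition reduced_index (i : 'I_(#|J| + nt)) : 'I_(n + nt) :=
  match fintype.split i with
  | inl a => lshift nt (enum_val a)
  | inr b => rshift n b
  end.

(* X(tilde x, theta), regarded as a polynomial matrix in (x, theta). *)
Definition unreduce p q (X : 'M[mpoly (#|J| + nt) R]_(p, q)) :
    'M[mpoly (n + nt) R]_(p, q) :=
  map_mx (rename reduced_index) X.

End ReducedState.

Definition xvec : 'cV[mpoly n R]_n := \col_i pvar i.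

Definition cpoly (C : 'I_n -> 'rV[mpoly n R]_n) (j : 'I_n) : mpoly n R :=
  1 - (xvec^T *m (C j)^T *m C j *m xvec) 0 0.

Definition h_xt Nt (h : 'I_Nt -> mpoly nt R) i : mpoly (n + nt) R :=
  embR n (h i).

Definition c_xt (C : 'I_n -> 'rV[mpoly n R]_n) j : mpoly (n + nt) R :=
  embL nt (cpoly C j).

(* F_1(x, theta, theta'); the sum over J is written in the variables
   (x, theta) first. *)
Definition F1 (A : 'M[mpoly (n + nt) R]_n) (B : 'M[mpoly (n + nt) R]_(n, m))
    (X : 'M[mpoly (#|zero_rows B| + nt) R]_n) (Y : 'M[mpoly (n + nt) R]_(m, n)) :
    'M[mpoly (n + nt + nt) R]_n :=
  let Xf := unreduce X in
  let S := A *m Xf + B *m Y in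
  let x := map_mx (embL nt) xvec in
  map_mx (embL nt)
    (S + S^T - \sum_(j in zero_rows B)
       (row j A *m x) 0 0 *: map_mx (mderiv (lshift nt j)) Xf)
  - \sum_(k < nt)
      pvar (rshift (n + nt) k) *:
        map_mx (embL nt) (map_mx (mderiv (rshift n k)) Xf).

Definition lmi_lower Nt (h : 'I_Nt -> mpoly nt R) (C : 'I_n -> 'rV[mpoly n R]_n)
    (Xf : 'M[mpoly (n + nt) R]_n) (eps : R)
    (lam : 'I_Nt -> mpoly (n + nt + n) R) (mu : 'I_n -> mpoly (n + nt + n) R) :=
  is_sos (qform (map_mx (embL n) (Xf - (mpolyC _ eps)%:M))
                (\col_i pvar (rshift (n + nt) i))
          - \sum_i lam i * embL n (h_xt h i)
          - \sum_j mu j * embL n (c_xt C j)).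

Definition lmi_upper Nt (h : 'I_Nt -> mpoly nt R) (C : 'I_n -> 'rV[mpoly n R]_n)
    (Xf : 'M[mpoly (n + nt) R]_n) (eps : R)
    (lam : 'I_Nt -> mpoly (n + nt + n) R) (mu : 'I_n -> mpoly (n + nt + n) R) :=
  is_sos (qform (map_mx (embL n) ((mpolyC _ eps)%:M - Xf))
                (\col_i pvar (rshift (n + nt) i))
          - \sum_i lam i * embL n (h_xt h i)
          - \sum_j mu j * embL n (c_xt C j)).

Definition lmi_decrease Nt (h : 'I_Nt -> mpoly nt R) (C : 'I_n -> 'rV[mpoly n R]_n)
    (vlo vhi : 'cV[R]_nt) (F : 'M[mpoly (n + nt + nt) R]_n) (eps : R)
    (lam : 'I_Nt -> mpoly (n + nt + nt + n) R)
    (mu : 'I_n -> mpoly (n + nt + nt + n) R)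
    (xi : 'I_nt -> mpoly (n + nt + nt + n) R) :=
  let dth (k : 'I_nt) := pvar (lshift n (rshift (n + nt) k)) in
  is_sos (- qform (map_mx (embL n) (F + (mpolyC _ eps)%:M))
                  (\col_i pvar (rshift (n + nt + nt) i))
          - \sum_i lam i * embL n (embL nt (h_xt h i))
          - \sum_j mu j * embL n (embL nt (c_xt C j))
          - \sum_k xi k * (dth k - mpolyC _ (vlo k 0)) * (mpolyC _ (vhi k 0) - dth k)).

Definition lmi_inclusion Nt (h : 'I_Nt -> mpoly nt R)
    (C : 'I_n -> 'rV[mpoly n R]_n) (Xf : 'M[mpoly (n + nt) R]_n) (j : 'I_n)
    (alpha : 'I_Nt -> mpoly (n + nt + (1 + n)) R) :=
  let CX := map_mx (embL nt) (C j) *m Xf in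
  is_sos (qform (map_mx (embL (1 + n)) (block_mx 1%:M CX CX^T Xf))
                (\col_i pvar (rshift (n + nt) i))
          - \sum_i alpha i * embL (1 + n) (h_xt h i)).

Definition state_set (C : 'I_n -> 'rV[mpoly n R]_n) : set 'cV[R]_n :=
  [set x | forall j, 0 <= peval x (cpoly C j)].

Definition Theta Nt (h : 'I_Nt -> mpoly nt R) : set 'cV[R]_nt :=
  [set th | forall i, 0 <= peval th (h i)].

Definition rectangle (vlo vhi : 'cV[R]_nt) : set 'cV[R]_nt :=
  [set v | forall k, vlo k 0 <= v k 0 <= vhi k 0].

Section ClosedLoop.
Variables (A : 'M[mpoly (n + nt) R]_n) (B : 'M[mpoly (n + nt) R]_(n, m)).
Variables (X : 'M[mpoly (#|zero_rows B| + nt) R]_n).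
Variable (Y : 'M[mpoly (n + nt) R]_(m, n)).

Definition Xval (x : 'cV[R]_n) (th : 'cV[R]_nt) : 'M[R]_n :=
  mxeval (col_mx (reduced_state (zero_rows B) x) th) X.

(* [invmx] is the identity on singular matrices, so the controller and V are
   meaningful on this set only. *)
Definition cl_domain : set ('cV[R]_n * 'cV[R]_nt) :=
  [set z | Xval z.1 z.2 \in unitmx].

Definition controller (x : 'cV[R]_n) (th : 'cV[R]_nt) : 'cV[R]_m :=
  mxeval (col_mx x th) Y *m invmx (Xval x th) *m x.

Definition closed_loop (x : 'cV[R]_n) (th : 'cV[R]_nt) : 'cV[R]_n :=
  mxeval (col_mx x th) A *m x + mxeval (col_mx x th) B *m controller x th.

Definition lyap (x : 'cV[R]_n) (th : 'cV[R]_nt) : R :=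
  (x^T *m invmx (Xval x th) *m x) 0 0.

Definition Omega (Th : set 'cV[R]_nt) (c : R) : set ('cV[R]_n * 'cV[R]_nt) :=
  [set z | [/\ cl_domain z, lyap z.1 z.2 <= c & Th z.2]].

End ClosedLoop.

End ParameterVaryingSystem.

Section Dynamics.
Context {R : realType}.

Definition norm2 k (v : 'cV[R]_k) : R := Num.sqrt (\sum_i v i 0 ^+ 2).

(* The half-open interval t0 <= t < T, with T possibly infinite. *)
Definition horizon (t0 : R) (T : \bar R) : set R :=
  [set t | t0 <= t /\ (t%:E < T)%E].

(* One-sided at an end point of D that belongs to D. *)
Definition has_deriv_within (D : set R) (f : R -> R) (t l : R) : Prop :=
  (f s - f t) / (s - t) @[s --> within D t^'] --> l.

Context {n nt : nat}.
Variables (Th W : set 'cV[R]_nt).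

Definition admissible (th : R -> 'cV[R]_nt) : Prop :=
  forall t, 0 <= t ->
    Th (th t) /\
    exists2 v, W v &
      forall k, has_deriv_within (horizon 0 +oo%E) (fun s => th s k 0) t (v k 0).

Variables (dom : set ('cV[R]_n * 'cV[R]_nt)).
Variables (f : 'cV[R]_n -> 'cV[R]_nt -> 'cV[R]_n).

Definition solution (th : R -> 'cV[R]_nt) (t0 : R) (T : \bar R)
    (x : R -> 'cV[R]_n) : Prop :=
  forall t, horizon t0 T t ->
    dom (x t, th t) /\
    forall i, has_deriv_within (horizon t0 T) (fun s => x s i 0) t (f (x t) (th t) i 0).

(* Global existence is part of the notion; the decay estimate is required of
   every solution, on whatever interval [t0, T[ it is defined. *)
Definition exponentially_stable : Prop :=
  exists k g c : R, [/\ 0 < k, 0 < g, 0 < c &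
    forall th, admissible th -> forall t0, 0 <= t0 ->
    forall x0, norm2 x0 < c ->
      (exists2 x, solution th t0 +oo%E x & x t0 = x0) /\
      (forall T x, solution th t0 T x -> x t0 = x0 ->
        forall t, horizon t0 T t ->
          norm2 (x t) <= k * norm2 (x t0) * expR (- (g * (t - t0))))].

Definition lyapunov_certificate (S : set 'cV[R]_n)
    (V : 'cV[R]_n -> 'cV[R]_nt -> R) : Prop :=
  exists a1 a2 a3 : R, [/\ 0 < a1, 0 < a2, 0 < a3,
    forall x th, S x -> Th th ->
      dom (x, th) /\ a1 * norm2 x ^+ 2 <= V x th <= a2 * norm2 x ^+ 2 &
    forall th, admissible th -> forall t0, 0 <= t0 ->
    forall T x, solution th t0 T x ->
    forall t, horizon t0 T t -> S (x t) ->
      exists2 d, has_deriv_within (horizon t0 T) (fun s => V (x s) (th s)) t d &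
        d <= - a3 * norm2 (x t) ^+ 2].

Definition region_of_attraction : set ('cV[R]_n * 'cV[R]_nt) :=
  [set z | forall th, admissible th -> th 0 = z.2 ->
    (exists2 x, solution th 0 +oo%E x & x 0 = z.1) /\
    (forall x, solution th 0 +oo%E x -> x 0 = z.1 ->
      x t @[t --> +oo] --> (0 : 'cV[R]_n))].

End Dynamics.

(* Main.v *)
Require Import Defs.
From HB Require Import structures.
From mathcomp Require Import all_boot all_order all_algebra.
From mathcomp Require Import -(notations) mpoly.
From mathcomp Require Import all_classical all_reals all_analysis.
From mathcomp Require Import perm ring lra.
Import Order.TTheory GRing.Theory Num.Theory.
Import numFieldNormedType.Exports.
Local Open Scope classical_set_scope.
Local Open Scope ring_scope.

(* Put w = X^-1 x. Then V = w^T X w, and since the rows of B indexed by J vanish,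
   the derivative of V along the closed loop is w^T F_1 w; the third condition
   bounds it by - eps3 |w|^2, while the first two compare |w|^2, V and |x|^2.
   The fourth condition, at (- C_j x, w), reads (C_j x)^2 <= V, so that V <= 1
   forces x into the state set. As V strictly decreases where V = 1, the sublevel
   set V <= 1 is invariant, and V decays exponentially on it.
   For existence, the closed-loop field is modified outside V <= 1 into one that
   is Lipschitz in x, locally uniformly in time. Picard iteration solves the
   modified equation globally, and the invariance argument, which only looks at
   the field on V <= 1, shows that its solution solves the closed loop. *)

Set Implicit Arguments.
Unset Strict Implicit.
Unset Printing Implicit Defensive.

(** * Derivatives within a set *)

(** The obstacle is that [X] is controlled only on the state set, while the argument also has to
    rule out that a trajectory reaches a point where [X] is singular and [V] meaningless. Two
    features remove the circularity. The fourth condition carries no multiplier of the [c_j], so it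
    holds at every [x] and can itself prove membership in the state set. And the state set is closed
    and described by polynomials: a limit of points with V <= 1 stays in it, there [X] is bounded
    below by [eps1], hence invertible, and only then is [V] continuous at the limit. Derivatives are
    one-sided at end points and the derivative of [theta] need not be continuous, so monotonicity
    and invariance rest on induction along the time interval rather than on integrating V'. The
    derivative of [V] comes from an exact formula for the increments of x^T X^-1 x, in which X^-1 x
    only has to be continuous. *)

(** Let [c] be the supremum of the initial segments on which [P] holds: the closure at left limits
    gives [P c], and the right step would pass beyond [c] unless [c = t1]. *)
Lemma real_induction {R : realType} (t0 t1 : R) (P : R -> Prop) :
  t0 <= t1 -> P t0 ->
  (forall t, t0 <= t -> t < t1 -> P t ->
     exists2 e, 0 < e & forall s, t < s -> s < t + e -> s <= t1 -> P s) ->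
  (forall t, t0 < t -> t <= t1 -> (forall s, t0 <= s -> s < t -> P s) -> P t) ->
  P t1.
Proof.
move=> t01 P0 Pright Pleft.
pose S := [set t | t0 <= t <= t1 /\ forall s, t0 <= s -> s <= t -> P s].
have St0 : S t0.
  split; first by rewrite lexx t01.
  by move=> s ts st; have -> : s = t0 by apply/eqP; rewrite eq_le ts st.
have supS : has_sup S by split; [exists t0 | exists t1 => t [] /andP[]].
set c := sup S.
have t0c : t0 <= c by exact: (sup_upper_bound supS).
have ct1 : c <= t1 by apply: ge_sup; [exists t0 | move=> t [] /andP[]].
have Pltc s : t0 <= s -> s < c -> P s.
  move=> ts sc; have cs : 0 < c - s by rewrite subr_gt0.
  have [u [_ Pu]] := sup_adherent cs supS.
  by rewrite -/c opprB addrC subrK => su; apply: Pu => //; exact: ltW.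
have Pc : P c.
  have [<-//|t0ltc] := eqVneq t0 c; apply: Pleft => //.
  by rewrite lt_neqAle t0ltc.
have [<-//|cneq] := eqVneq c t1.
have cltt1 : c < t1 by rewrite lt_neqAle cneq.
have [e e0 Pe] := Pright c t0c cltt1 Pc.
pose d := Num.min (c + e / 2) t1.
have cd : c < d by rewrite /d lt_min cltt1 andbT ltrDl divr_gt0.
have de : d < c + e.
  rewrite /d gt_min ltrD2l gtr_pMr ?invf_lt1 ?ltr1n //.
have dt1 : d <= t1 by rewrite /d ge_min lexx orbT.
have Sd : S d.
  split; first by rewrite (le_trans t0c (ltW cd)) dt1.
  move=> s ts sd; have [sc|cs|->//] := ltgtP s c; first exact: Pltc.
  by apply: Pe => //; [exact: le_lt_trans de|exact: le_trans dt1].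
by have := sup_upper_bound supS Sd; rewrite leNgt cd.
Qed.

Section DerivativeWithin.
Context {R : realType}.
Implicit Types (D : set R) (f g : R -> R) (t l : R).

Lemma near_within_dnbhsP D t (Q : R -> Prop) :
  (\forall s \near within D t^', Q s) ->
  exists2 e, 0 < e & forall s, D s -> s != t -> `|s - t| < e -> Q s.
Proof.
move=> /nbhs_ballP[e /= e0 He]; exists e => // s Ds st se.
by apply: He => //; rewrite /ball /= distrC.
Qed.

Lemma cvg_within_lt D t f l c :
  f s @[s --> within D t^'] --> l -> l < c ->
  exists2 e, 0 < e & forall s, D s -> s != t -> `|s - t| < e -> f s < c.
Proof. by move=> fl lc; apply: near_within_dnbhsP; exact: cvgr_lt lc. Qed.

Lemma cvg_within_gt D t f l c :
  f s @[s --> within D t^'] --> l -> c < l ->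
  exists2 e, 0 < e & forall s, D s -> s != t -> `|s - t| < e -> c < f s.
Proof. by move=> fl lc; apply: near_within_dnbhsP; exact: cvgr_gt lc. Qed.

Lemma has_deriv_withinW D D' f t l : D' `<=` D ->
  has_deriv_within D f t l -> has_deriv_within D' f t l.
Proof.
move=> DD' fl; apply: (cvg_trans _ fl); apply: cvg_app => A.
change (t^' (fun s => D s -> A s) -> t^' (fun s => D' s -> A s)).
by apply: filterS => s As /DD'.
Qed.

Lemma eq_has_deriv_within D f g t l : D t ->
  (forall s, D s -> f s = g s) ->
  has_deriv_within D f t l -> has_deriv_within D g t l.
Proof.
move=> Dt fg; rewrite /has_deriv_within; apply: cvg_trans.
apply: near_eq_cvg; rewrite near_withinE; near=> s => Ds.
by rewrite !fg.
Unshelve. all: by end_near. Qed.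

Lemma has_deriv_within_cst D t (c : R) : has_deriv_within D (fun=> c) t 0.
Proof.
rewrite /has_deriv_within subrr; under eq_fun do rewrite mul0r; exact: cvg_cst.
Qed.

Lemma has_deriv_within_id D t : has_deriv_within D id t 1.
Proof.
rewrite /has_deriv_within.
apply: (@cvg_trans _ ((fun=> 1 : R) @ within D t^')); last exact: cvg_cst.
apply: near_eq_cvg; rewrite near_withinE.
have := nbhs_dnbhs_neq t; apply: filterS => s st _.
by rewrite /= divff // subr_eq0.
Qed.

(** For [s] different from [t], [f s] is [f t] plus the difference quotient times [s - t], and the
    last factor tends to 0. *)
Lemma has_deriv_within_cvg D f t l :
  has_deriv_within D f t l -> f s @[s --> within D t^'] --> f t.
Proof.
move=> fl.
have idt : (s - t) @[s --> within D t^'] --> (0 : R).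
  rewrite -(subrr t); apply: cvgB; last exact: cvg_cst.
  apply: cvg_within_filter; exact: nbhs_dnbhs.
have -> : f t = f t + l * 0 by rewrite mulr0 addr0.
apply: cvg_trans; last exact: (cvgD (cvg_cst (f t)) (cvgM fl idt)).
apply: near_eq_cvg.
rewrite near_withinE; have := nbhs_dnbhs_neq t; apply: filterS => s st _.
by rewrite /GRing.add /GRing.mul /= mulfVK ?subr_eq0 // addrC subrK.
Qed.

Lemma has_deriv_withinD D f g t l k :
  has_deriv_within D f t l -> has_deriv_within D g t k ->
  has_deriv_within D (fun s => f s + g s) t (l + k).
Proof.
move=> fl gk; rewrite /has_deriv_within.
apply: cvg_trans; last exact: (cvgD fl gk).
apply: near_eq_cvg; near=> s.
by rewrite -mulrDl opprD addrACA.
Unshelve. all: by end_near. Qed.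

Lemma has_deriv_withinM D f g t l k :
  has_deriv_within D f t l -> has_deriv_within D g t k ->
  has_deriv_within D (fun s => f s * g s) t (l * g t + f t * k).
Proof.
move=> fl gk; rewrite /has_deriv_within.
apply: cvg_trans; last exact: (cvgD (cvgM fl (has_deriv_within_cvg gk))
  (cvgM (cvg_cst (f t)) gk)).
apply: near_eq_cvg; near=> s.
rewrite -[LHS]/((f s - f t) / (s - t) * g s + f t * ((g s - g t) / (s - t))).
ring.
Unshelve. all: by end_near. Qed.

Lemma has_deriv_withinZ D f t l (c : R) :
  has_deriv_within D f t l -> has_deriv_within D (fun s => c * f s) t (c * l).
Proof.
move=> fl; have := has_deriv_withinM (has_deriv_within_cst D t c) fl.
by rewrite mul0r add0r.
Qed.

Lemma has_deriv_withinN D f t l :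
  has_deriv_within D f t l -> has_deriv_within D (fun s => - f s) t (- l).
Proof.
move=> /(has_deriv_withinZ (c := -1)); rewrite mulN1r.
by under eq_fun do rewrite mulN1r.
Qed.

Lemma has_deriv_withinB D f g t l k :
  has_deriv_within D f t l -> has_deriv_within D g t k ->
  has_deriv_within D (fun s => f s - g s) t (l - k).
Proof. by move=> fl /has_deriv_withinN; exact: has_deriv_withinD. Qed.

Lemma is_derive_has_deriv_within D f t l :
  is_derive t 1 f l -> has_deriv_within D f t l.
Proof.
move=> [df dE].
apply: (@cvg_trans _ ((f s - f t) / (s - t) @[s --> t^'])).
  exact/cvg_app/cvg_within.
have : (fun h => h^-1 *: (f (h *: (1 : R) + t) - f t)) @ (0 : R)^' --> l.
  by rewrite -dE; exact: df.
move=> H; apply/cvgrPdist_lt => e e0.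
move/cvgrPdist_lt/(_ e e0)/nbhs_ballP: H => [d /= d0 Hd].
apply/nbhs_ballP; exists d => // s; rewrite /ball /= => ts st.
have := Hd (s - t); rewrite /ball /= sub0r opprB => /(_ ts).
rewrite subr_eq0 => /(_ st).
by rewrite /GRing.scale /= mulr1 subrK mulrC.
Qed.

Lemma has_deriv_within_expR D t (a t0 : R) :
  has_deriv_within D (fun s => expR (a * (s - t0))) t (a * expR (a * (t - t0))).
Proof.
apply: is_derive_has_deriv_within.
have h1 : is_derive t 1 (fun s : R => a * (s - t0)) a.
  rewrite -[fun s => _]/(a \*: (@id R - cst t0)).
  by apply: is_derive_eq; rewrite /GRing.scale /= subr0 mulr1.
rewrite mulrC.
exact: (@is_derive1_comp _ expR (fun s => a * (s - t0)) t _ _ (is_derive_expR _) h1).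
Qed.

Lemma has_deriv_within_right_lt D f t l (c : R) :
  has_deriv_within D f t l -> l < c ->
  exists2 e, 0 < e &
    forall s, D s -> t < s -> s < t + e -> f s - f t < c * (s - t).
Proof.
move=> fl lc.
have [e e0 He] := cvg_within_lt fl lc.
exists e => // s Ds ts se.
have st0 : 0 < s - t by rewrite subr_gt0.
rewrite -ltr_pdivrMr //; apply: He => //; first by rewrite gt_eqF.
by rewrite gtr0_norm // ltrBlDl.
Qed.

End DerivativeWithin.

(** * Monotonicity and closedness along a time interval *)

Section Comparison.
Context {R : realType} (t0 : R) (T : \bar R).
Let D := horizon t0 T.

Lemma horizon_le s t : D t -> t0 <= s -> s <= t -> D s.
Proof.
move=> [t0t tT] t0s st; split => //.
by apply: le_lt_trans tT; rewrite lee_fin.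
Qed.

(** A slope at most 0 lies strictly below every [e > 0], so the bound with slack [e * (t - t0)]
    propagates to the right; real induction carries it to [t], and [e] is then arbitrary. *)
Lemma nonincreasing_of_deriv (W : R -> R) :
  (forall t, D t -> exists2 l, has_deriv_within D W t l & l <= 0) ->
  forall t, D t -> W t <= W t0.
Proof.
move=> dW t Dt; have t0t : t0 <= t by case: Dt.
suff H e : 0 < e -> W t <= W t0 + e * (t - t0).
  apply/ler_addgt0Pr => e e0.
  have h : 0 < t - t0 + 1 by rewrite ltr_wpDl // subr_ge0.
  (* The [+ 1] keeps the divisor positive when [t = t0]. *)
  have := H (e / (t - t0 + 1)) (divr_gt0 e0 h) => /le_trans; apply.
  rewrite lerD2l mulrAC ler_pdivrMr // ler_pM2l //.
  by rewrite lerDl.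
move=> e0.
apply: (real_induction (t0 := t0) (t1 := t) (P := fun t => W t <= W t0 + e * (t - t0))) => //.
- by rewrite subrr mulr0 addr0.
- move=> s t0s st Ws.
  have Ds : D s by apply: (horizon_le Dt) => //; exact: ltW.
  have [l dl l0] := dW s Ds; have we : l < e by apply: le_lt_trans l0 e0.
  have [d d0 Hd] := has_deriv_within_right_lt dl we.
  exists d => // u su ud ut.
  have Du : D u by apply: (horizon_le Dt) => //; apply/ltW/(le_lt_trans t0s).
  have := Hd u Du su ud; lra.
- move=> s t0s st Ws.
  have Ds : D s by apply: (horizon_le Dt) => //; exact: ltW.
  rewrite leNgt; apply/negP => lt_W; have [l dl _] := dW s Ds.
  (* Subtracting the slack leaves the constant bound [W t0] before [s], and a constant bound
     survives the limit from the left. *)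
  have h : has_deriv_within D (fun u => W u - e * (u - t0)) s (l - e * (1 - 0)).
    apply: has_deriv_withinB; first exact: dl.
    apply/has_deriv_withinZ/has_deriv_withinB.
      exact: has_deriv_within_id.
    exact: has_deriv_within_cst.
  have lt' : W t0 < W s - e * (s - t0) by rewrite ltrBrDr.
  have [d d0 Hd] := cvg_within_gt (has_deriv_within_cvg h) lt'.
  pose u := Num.max t0 (s - d / 2).
  have us : u < s by rewrite /u gt_max t0s ltrBlDr ltrDl divr_gt0.
  have t0u : t0 <= u by rewrite /u le_max lexx.
  have Du : D u by apply: (horizon_le Ds) => //; exact: ltW.
  have := Hd u Du; rewrite lt_eqF // ltr0_norm ?subr_lt0 // => /(_ isT).
  have -> : - (u - s) < d.
    have : s - d / 2 <= u by rewrite /u le_max lexx orbT.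
    lra.
  by move=> /(_ isT); have := Ws u t0u us; lra.
Qed.

(** The closedness step of the invariance argument, meant for the [c_j] and for 1 - V. *)
Lemma left_limit_ge0 (W : R -> R) t : D t -> t0 < t ->
  W s @[s --> within D t^'] --> W t ->
  (forall s, t0 <= s -> s < t -> 0 <= W s) -> 0 <= W t.
Proof.
move=> Dt t0t cW Wge; rewrite leNgt; apply/negP => Wt.
have [d d0 Hd] := cvg_within_lt cW Wt.
pose u := Num.max t0 (t - d / 2).
have us : u < t by rewrite /u gt_max t0t ltrBlDr ltrDl divr_gt0.
have t0u : t0 <= u by rewrite /u le_max lexx.
have Du : D u by apply: (horizon_le Dt) => //; exact: ltW.
have := Hd u Du; rewrite lt_eqF // ltr0_norm ?subr_lt0 // => /(_ isT).
have -> : - (u - t) < d.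
  have : t - d / 2 <= u by rewrite /u le_max lexx orbT.
  lra.
by move=> /(_ isT); have := Wge u t0u us; lra.
Qed.

End Comparison.

(** * Global solutions of locally uniformly Lipschitz equations *)

Section PicardIteration.
Context {R : realType}.

(** A mean value inequality: both [f - g] and [- f - g] have nonpositive derivative. *)
Lemma abs_increment_le (t0 : R) (T : \bar R) (f g f' g' : R -> R) :
  (forall t, horizon t0 T t -> has_deriv_within (horizon t0 T) f t (f' t)) ->
  (forall t, horizon t0 T t -> has_deriv_within (horizon t0 T) g t (g' t)) ->
  (forall t, horizon t0 T t -> `|f' t| <= g' t) ->
  forall t, horizon t0 T t -> `|f t - f t0| <= g t - g t0.
Proof.
move=> df dg fg t Dt.
have H1 : f t - g t <= f t0 - g t0.
  apply: (nonincreasing_of_deriv (W := fun s => f s - g s) _ Dt) => // s Ds.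
  exists (f' s - g' s); first by apply: has_deriv_withinB; [exact: df|exact: dg].
  by have := fg s Ds; rewrite ler_norml => /andP[]; lra.
have H2 : - f t - g t <= - f t0 - g t0.
  apply: (nonincreasing_of_deriv (W := fun s => - f s - g s) _ Dt) => // s Ds.
  exists (- f' s - g' s).
    by apply: has_deriv_withinB; [apply/has_deriv_withinN/df|exact: dg].
  by have := fg s Ds; rewrite ler_norml => /andP[]; lra.
by rewrite ler_norml; apply/andP; split; lra.
Qed.

Lemma le0_of_le_geometric (a C : R) : (forall k : nat, a <= C / 2 ^+ k) -> a <= 0.
Proof.
move=> H; rewrite leNgt; apply/negP => a0.
have h : `|2^-1 : R| < 1 by rewrite ger0_norm ?invr_ge0 // invf_lt1 ?ltr1n.
have [N _ /(_ N (leqnn N))] := cvgr_lt _ (cvg_geometric C h) _ a0.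
by rewrite /geometric /= exprVn ltNge H.
Qed.

(** With [b k] the sum of all the bounds from index [k] on, [u - b] is nondecreasing and [u + b] is
    nonincreasing; their common limit is enclosed at every index, which gives convergence and its
    rate together. *)
Lemma geometric_cauchy_limit (u : nat -> R) (K : R) :
  (forall k, `|u k.+1 - u k| <= K / 2 ^+ k) ->
  forall k, `|limn u - u k| <= 2 * K / 2 ^+ k.
Proof.
move=> H.
have p2 k : 0 < (2 : R) ^+ k by rewrite exprn_gt0.
have K0 : 0 <= K by have := le_trans (normr_ge0 _) (H 0); rewrite expr0 divr1.
pose b k := 2 * K / 2 ^+ k : R.
have bS k : K / 2 ^+ k = b k - b k.+1.
  by rewrite /b exprS invfM; field; rewrite gt_eqF.
pose lo k := u k - b k; pose hi k := u k + b k.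
have nd : nondecreasing_seq lo.
  apply/nondecreasing_seqP => k; have := H k; rewrite bS ler_norml /lo; lra.
have ni : nonincreasing_seq hi.
  apply/nonincreasing_seqP => k; have := H k; rewrite bS ler_norml /hi; lra.
have b0 k : 0 <= b k by rewrite /b divr_ge0 ?mulr_ge0 // ltW.
have clo : cvgn lo.
  apply: nondecreasing_is_cvgn => //; exists (hi 0) => _ [k _ <-].
  by apply: le_trans (ni 0 k (leq0n _)); rewrite /lo /hi; have := b0 k; lra.
have bto0 : b @ \oo --> (0 : R).
  have h : `|2^-1 : R| < 1 by rewrite ger0_norm ?invr_ge0 // invf_lt1 ?ltr1n.
  apply: cvg_trans (cvg_geometric (2 * K) h); apply: near_eq_cvg; near=> k.
  by rewrite /b /geometric /= exprVn.
have cu : u @ \oo --> limn lo.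
  rewrite -[limn lo]addr0; apply: cvg_trans (cvgD clo bto0).
  by apply: near_eq_cvg; near=> k; rewrite /lo /GRing.add /= subrK.
have chi : hi @ \oo --> limn lo.
  by rewrite -[limn lo]addr0; exact: cvgD.
move=> k; have -> : limn u = limn lo by apply: cvg_lim.
have h1 := nondecreasing_cvgn_le nd clo k.
have h2 : limn lo <= hi k.
  rewrite -(cvg_lim (@Rhausdorff R) chi).
  by apply: nonincreasing_cvgn_ge => //; apply/cvg_ex; exists (limn lo).
by rewrite ler_norml; move: h1 h2; rewrite /lo /hi -/(b k); lra.
Unshelve. all: by end_near. Qed.

Lemma continuous_antiderivative (t0 : R) (f : R -> R) : continuous f ->
  exists2 F : R -> R, F t0 = 0 & forall t, t0 <= t -> is_derive t 1 F (f t).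
Proof.
(* The integral starts at [t0 - 1] so that [t0] is an interior point and the derivative there is
   two-sided. *)
move=> cf; pose I x := (\int[lebesgue_measure]_(s in `[t0 - 1, x]) f s)%R.
exists (fun x => I x - I t0) => [|t t0t]; first by rewrite subrr.
have [dI II] : derivable I t 1 /\ I^`()%classic t = f t.
  apply: (@continuous_FTC1_closed _ f (t0 - 1) t (t + 1)).
  - by rewrite ltrDl.
  - apply: continuous_compact_integrable; first exact: segment_compact.
    exact: continuous_subspaceT.
  - by rewrite ltrBlDr (le_lt_trans t0t) // ltrDl.
  - exact: cf.
have h : is_derive t 1 I (f t) by apply: DeriveDef; [exact: dI|rewrite -derive1E; exact: II].
have := is_deriveB h (is_derive_cst (I t0) t 1); rewrite subr0.
by [].
Qed.

Lemma finite_uniform_bound (n : nat) (Q : 'I_n -> R -> Prop) :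
  (forall i a b, a <= b -> Q i a -> Q i b) ->
  (forall i, exists a, Q i a) -> exists2 a, 0 <= a & forall i, Q i a.
Proof.
move=> Qmono /choice[a Qa]; exists (\sum_i `|a i|); first exact: sumr_ge0.
move=> i; apply: Qmono (Qa i); apply: le_trans (ler_norm _) _.
by rewrite (bigD1 i) //= lerDl sumr_ge0.
Qed.

Context {n : nat} (t0 : R) (G : R -> 'cV[R]_n -> 'cV[R]_n) (x0 : 'cV[R]_n).

Let ccont (u : R -> 'cV[R]_n) := forall i, continuous (fun s => u s i 0).

Hypothesis G_continuous :
  forall u, ccont u -> ccont (fun s => G s (u s)).

Hypothesis G_lipschitz : forall T, exists2 L, 0 < L &
  forall s, t0 <= s -> s <= T -> forall (u v : 'cV[R]_n) e, 0 <= e ->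
  (forall i, `|u i 0 - v i 0| <= e) ->
  forall i, `|G s u i 0 - G s v i 0| <= L * e.

Let D := horizon t0 +oo%E.

Lemma integral_operator_exists : exists P : (R -> 'cV[R]_n) -> (R -> 'cV[R]_n),
  forall u, ccont u -> [/\ ccont (P u), P u t0 = x0 &
    forall t, t0 <= t -> forall i,
      has_deriv_within D (fun s => P u s i 0) t (G t (u t) i 0)].
Proof.
pose Q u v := ccont u -> [/\ ccont v, v t0 = x0 &
    forall t, t0 <= t -> forall i,
      has_deriv_within D (fun s => v s i 0) t (G t (u t) i 0)].
suff /choice[P HP] : forall u, exists v, Q u v by exists P.
move=> u; have [cu|] := pselect (ccont u); last by move=> ncu; exists u.
have /choice[F HF] : forall i, exists F : R -> R, F t0 = 0 /\
    forall t, t0 <= t -> is_derive t 1 F (G t (u t) i 0).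
  by move=> i; have [F F0 dF] := continuous_antiderivative t0 (@G_continuous u cu i);
    exists F.
(* The antiderivatives are only known from [t0] on; freezing time before [t0] makes the image curve
   continuous on the whole line, so that the operator can be iterated. *)
exists (fun s => \col_i (x0 i 0 + F i (Num.max s t0))) => _; split.
- move=> i; under eq_fun do rewrite mxE.
  move=> s; apply: cvgD; first exact: cvg_cst.
  apply: (@continuous_comp _ _ _ (fun s => Num.max s t0) (F i)).
    by apply: continuous_max => //; exact: cvg_cst.
  apply: differentiable_continuous; apply/derivable1_diffP.
  by have [_ /(_ (Num.max s t0))] := HF i; rewrite le_max lexx orbT => /(_ isT) [].
- by apply/colP => i; rewrite mxE maxxx (HF i).1 addr0.
- move=> t t0t i; have Dt : D t by split => //; rewrite ltry.
  apply: (eq_has_deriv_within (f := fun s => x0 i 0 + F i s)) => //.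
    by move=> s [t0s _]; rewrite mxE max_l.
  rewrite -[G t (u t) i 0]add0r; apply: has_deriv_withinD.
    exact: has_deriv_within_cst.
  by apply: is_derive_has_deriv_within; apply: (HF i).2.
Qed.

(** The Lipschitz constant depends on the time bound [T], but the operator [P] and its iterates do
    not. The iterates therefore converge on every bounded time interval, each with its own weight,
    and the pointwise limits form a single global curve. *)
Theorem lipschitz_ode_global_solution : exists2 x : R -> 'cV[R]_n,
  x t0 = x0 & forall t, t0 <= t -> forall i,
    has_deriv_within D (fun s => x s i 0) t (G t (x t) i 0).
Proof.
have [P HP] := integral_operator_exists.
(* The weight [expR (2 * L * (t - t0))] makes [P] a contraction of ratio 1/2. *)
have contract T L : 0 < L ->
    (forall s, t0 <= s -> s <= T -> forall (u v : 'cV[R]_n) e, 0 <= e ->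
      (forall i, `|u i 0 - v i 0| <= e) ->
      forall i, `|G s u i 0 - G s v i 0| <= L * e) ->
    forall u v K, ccont u -> ccont v -> 0 <= K ->
    (forall t, t0 <= t -> t < T -> forall i,
       `|u t i 0 - v t i 0| <= K * expR (2 * L * (t - t0))) ->
    forall t, t0 <= t -> t < T -> forall i,
       `|P u t i 0 - P v t i 0| <= K / 2 * expR (2 * L * (t - t0)).
  move=> L0 HL u v K cu cv K0 Huv t t0t tT i.
  have [_ Pu0 dPu] := HP u cu; have [_ Pv0 dPv] := HP v cv.
  have DT : horizon t0 T%:E `<=` D by move=> s [t0s _]; split => //; rewrite ltry.
  have := @abs_increment_le t0 T%:E (fun s => P u s i 0 - P v s i 0)
    (fun s => K / 2 * expR (2 * L * (s - t0)))
    (fun s => G s (u s) i 0 - G s (v s) i 0)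
    (fun s => K / 2 * (2 * L * expR (2 * L * (s - t0)))).
  move=> /(_ _ _ _ t) H.
  have : `|P u t i 0 - P v t i 0 - (P u t0 i 0 - P v t0 i 0)| <=
      K / 2 * expR (2 * L * (t - t0)) - K / 2 * expR (2 * L * (t0 - t0)).
    apply: H => [s Ds|s Ds|s [t0s sT]|].
    - apply: (has_deriv_withinW DT).
      by apply: has_deriv_withinB; [apply: dPu|apply: dPv]; case: Ds.
    - exact/has_deriv_withinZ/has_deriv_within_expR.
    - rewrite lte_fin in sT.
      have -> : K / 2 * (2 * L * expR (2 * L * (s - t0))) =
          L * (K * expR (2 * L * (s - t0))) by field.
      apply: HL => //; first exact: ltW.
        by rewrite mulr_ge0 // expR_ge0.
      by move=> j; exact: Huv.
    - by split => //; rewrite lte_fin.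
  rewrite Pu0 Pv0 subrr subr0 => /le_trans; apply.
  by rewrite lerBlDr lerDl mulr_ge0 ?divr_ge0 // expR_ge0.
pose x k := iter k P (fun=> x0).
have cx k : ccont (x k).
  elim: k => [|k IH] /=; first by move=> i s; exact: cvg_cst.
  by case: (HP _ IH).
have step T : exists2 K, 0 <= K & forall t, t0 <= t -> t < T -> forall k i,
    `|x k.+1 t i 0 - x k t i 0| <= K / 2 ^+ k.
  have [L L0 HL] := G_lipschitz T.
  (* The first Picard increment is continuous, hence bounded on the compact interval; the
     contraction then halves this bound at each step. *)
  have [K K0 HK] : exists2 K, 0 <= K & forall i, forall t, t0 <= t -> t < T ->
      `|x 1 t i 0 - x 0 t i 0| <= K.
    apply: finite_uniform_bound => [i a b ab H t t0t tT|i].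
      exact: le_trans (H t t0t tT) ab.
    have [t0T|Tt0] := leP t0 T; last first.
      by exists 0 => t t0t tT; have := lt_trans (le_lt_trans t0t tT) Tt0; rewrite ltxx.
    have cf : {within `[t0, T], continuous (fun t => `|x 1 t i 0 - x 0 t i 0|)}.
      apply: continuous_subspaceT => s; apply: cvg_norm; apply: cvgB.
        exact: (cx 1 i).
      exact: (cx 0 i).
    have [c _ Hc] := EVT_max t0T cf.
    exists (`|x 1 c i 0 - x 0 c i 0|) => t t0t tT.
    by apply: Hc; rewrite in_itv /= t0t ltW.
  exists (K * expR (2 * L * (T - t0))); first by rewrite mulr_ge0 // expR_ge0.
  move=> t t0t tT k i.
  have E s : s <= T -> expR (2 * L * (s - t0)) <= expR (2 * L * (T - t0)).
    by move=> sT; rewrite ler_expR ler_pM2l ?mulr_gt0 // lerB.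
  have : `|x k.+1 t i 0 - x k t i 0| <= K / 2 ^+ k * expR (2 * L * (t - t0)).
    elim: k t t0t tT i => [|k IH] t t0t tT i.
      rewrite expr0 divr1; apply: le_trans (HK i t t0t tT) _.
      rewrite ler_peMr // -[1]expR0 ler_expR mulr_ge0 ?subr_ge0 //.
      by rewrite mulr_ge0 // ltW.
    have -> : K / 2 ^+ k.+1 = K / 2 ^+ k / 2 by rewrite exprSr invfM mulrA.
    apply: (contract T L L0 HL (x k.+1) (x k)) => //.
    by rewrite divr_ge0 // exprn_ge0.
  move=> /le_trans; apply; rewrite mulrAC ler_wpM2r ?invr_ge0 ?exprn_ge0 //.
  by rewrite ler_wpM2l // E // ltW.
pose y t : 'cV[R]_n := \col_i limn (fun k => x k (Num.max t t0) i 0).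
have ylim T : exists2 K, 0 <= K & forall t, t < T -> forall k i,
    `|y t i 0 - x k (Num.max t t0) i 0| <= K / 2 ^+ k.
  have [K K0 HK] := step (Num.max T (t0 + 1)).
  exists (2 * K); first by rewrite mulr_ge0.
  move=> t tT k i; rewrite mxE.
  apply: (geometric_cauchy_limit (u := fun k => x k (Num.max t t0) i 0)) => j.
  apply: HK; first by rewrite le_max lexx orbT.
  by rewrite gt_max lt_max tT /= lt_max ltrDl ltr01 orbT.
have cy : ccont y.
  move=> i t; have [K K0 HK] := ylim (t + 1).
  have cxm k : x k (Num.max s t0) i 0 @[s --> t] --> x k (Num.max t t0) i 0.
    apply: (@continuous_comp _ _ _ (fun s => Num.max s t0) (fun s => x k s i 0)).
      by apply: continuous_max => //; exact: cvg_cst.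
    exact: cx.
  (* A uniform limit of continuous curves: [e] is split into the error of the [k]-th iterate at [t],
     the same error at [s], and the continuity of that iterate. *)
  apply/cvgrPdist_lt => e e0.
  have [k Hk] : exists k : nat, K / 2 ^+ k < e / 3.
    apply: contrapT => /forallNP H.
    have : e / 3 <= 0.
      apply: (le0_of_le_geometric (C := K)) => k; rewrite leNgt; apply/negP; exact: H.
    by rewrite leNgt divr_gt0.
  have e3 : 0 < e / 3 by rewrite divr_gt0.
  have /cvgrPdist_lt /(_ _ e3) H := cxm k.
  have lt1 : \forall s \near t, s < t + 1 by apply: lt_nbhsl; rewrite ltrDl.
  near=> s.
  have h1 : `|x k (Num.max t t0) i 0 - x k (Num.max s t0) i 0| < e / 3.
    by near: s; exact: H.
  have h2 : `|y t i 0 - x k (Num.max t t0) i 0| <= K / 2 ^+ k.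
    by apply: HK; rewrite ltrDl.
  have h3 : `|y s i 0 - x k (Num.max s t0) i 0| <= K / 2 ^+ k.
    by apply: HK; near: s.
  move: h1 h2 h3 Hk; set a := x k _ i 0; set b := x k _ i 0; set c := K / _.
  rewrite !ltr_norml !ler_norml => /andP[? ?] /andP[? ?] /andP[? ?] ?.
  apply/andP; split; lra.
have [cPy Py0 dPy] := HP y cy.
have yP t : t0 <= t -> P y t = y t.
  move=> t0t; apply/colP => i; apply/eqP; rewrite -subr_eq0 -normr_le0.
  have [L L0 HL] := G_lipschitz (t + 1).
  have [K K0 HK] := ylim (t + 1).
  have tt : t < t + 1 by rewrite ltrDl.
  (* Both [P y] and [y] are compared with the iterate [k + 1]: the first summand of the constant is
     the contraction error of [P y], the second the convergence error of [y]. *)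
  apply: (le0_of_le_geometric (C := K * expR (2 * L * (t - t0)) + K)) => k.
  have h1 : `|P y t i 0 - x k.+1 t i 0| <= K / 2 ^+ k / 2 * expR (2 * L * (t - t0)).
    apply: (contract (t + 1) L L0 HL y (x k)) => //.
      by rewrite divr_ge0 // exprn_ge0.
    move=> s t0s st j; have := HK s st k j; rewrite max_l // => /le_trans; apply.
    rewrite ler_peMr ?divr_ge0 ?exprn_ge0 // -[1]expR0 ler_expR mulr_ge0 ?subr_ge0 //.
    by rewrite mulr_ge0 // ltW.
  have h2 := HK t tt k.+1 i; rewrite max_l // in h2.
  have -> : P y t i 0 - y t i 0 = (P y t i 0 - x k.+1 t i 0) - (y t i 0 - x k.+1 t i 0).
    ring.
  apply: le_trans (ler_normB _ _) _; apply: le_trans (lerD h1 h2) _.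
  rewrite [leRHS]mulrDl lerD //.
    rewrite [leRHS]mulrAC ler_wpM2r ?expR_ge0 // ler_piMr ?divr_ge0 ?exprn_ge0 //.
    by rewrite invf_le1 ?ler1n.
  rewrite ler_wpM2l // lef_pV2 ?posrE ?exprn_gt0 // exprS ler_peMl ?exprn_ge0 //.
  by rewrite ler1n.
(* The witness is [P y], whose derivative is known, and the fixed point identity replaces [P y] by
   [y] inside [G]. *)
exists (P y) => // t t0t i; rewrite yP //; exact: dPy.
Unshelve. all: by end_near. Qed.

End PicardIteration.

(** * Evaluation of polynomials and of the SOS conditions *)

Section PolynomialEvaluation.
Context {R : realType}.

HB.instance Definition _ k (z : 'cV[R]_k) :=
  GRing.RMorphism.copy (peval z) (meval (fun i => z i 0)).

HB.instance Definition _ k l (f : 'I_k -> 'I_l) :=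
  GRing.RMorphism.copy (@rename R k l f)
    (comp_mpoly [tuple @pvar R l (f i) | i < k]).

Lemma pevalC k (z : 'cV[R]_k) c : peval z (mpolyC k c) = c.
Proof. exact: mevalC. Qed.

Lemma peval_pvar k (z : 'cV[R]_k) i : peval z (pvar i) = z i 0.
Proof. exact: mevalXU. Qed.

Lemma pevalN k (z : 'cV[R]_k) p : peval z (- p) = - peval z p.
Proof. exact: rmorphN. Qed.

Lemma pevalB k (z : 'cV[R]_k) p q : peval z (p - q) = peval z p - peval z q.
Proof. exact: rmorphB. Qed.

Lemma mxevalD k p q (z : 'cV[R]_k) (M N : 'M[mpoly k R]_(p, q)) :
  mxeval z (M + N) = mxeval z M + mxeval z N.
Proof. exact: map_mxD. Qed.

Lemma mxevalB k p q (z : 'cV[R]_k) (M N : 'M[mpoly k R]_(p, q)) :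
  mxeval z (M - N) = mxeval z M - mxeval z N.
Proof. exact: map_mxB. Qed.

Lemma mxevalM k p q r (z : 'cV[R]_k) (M : 'M[mpoly k R]_(p, q))
    (N : 'M[mpoly k R]_(q, r)) :
  mxeval z (M *m N) = mxeval z M *m mxeval z N.
Proof. exact: map_mxM. Qed.

Lemma mxeval_tr k p q (z : 'cV[R]_k) (M : 'M[mpoly k R]_(p, q)) :
  mxeval z M^T = (mxeval z M)^T.
Proof. by rewrite /mxeval map_trmx. Qed.

Lemma mxeval_scalar k p (z : 'cV[R]_k) c :
  mxeval z (mpolyC k c)%:M = (c%:M : 'M[R]_p).
Proof. by rewrite /mxeval map_scalar_mx; congr (_%:M); exact: pevalC. Qed.

Lemma rename_pvar k l (f : 'I_k -> 'I_l) i :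
  rename f (pvar i) = pvar (f i) :> mpoly l R.
Proof. by rewrite /rename /pvar comp_mpolyXU -tnth_nth tnth_mktuple. Qed.

Lemma renameC k l (f : 'I_k -> 'I_l) c : rename f (mpolyC k c) = mpolyC l c :> mpoly l R.
Proof. exact: comp_mpolyC. Qed.

(** Constants and variables generate the ring, so that facts on renaming, differentiation and
    continuity of polynomials reduce to closure under sums and products. *)
Lemma mpoly_ring_ind k (P : mpoly k R -> Prop) :
  (forall c, P (mpolyC k c)) -> (forall i, P (pvar i)) ->
  (forall p q, P p -> P q -> P (p + q)) -> (forall p q, P p -> P q -> P (p * q)) ->
  forall p, P p.
Proof.
move=> PC PX PD PM; elim/mpolyind => [|c m p _ _ Pp].
  by rewrite -(mpolyC0 _ R); exact: (PC).
apply: (PD) => //; rewrite -mul_mpolyC; apply: (PM) => //.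
rewrite mpolyXE_id; apply: (big_ind P) => [|p1 p2|i _].
- by rewrite -(mpolyC1 _ R); exact: (PC).
- exact: (PM).
elim: (m i) => [|j IH].
  by rewrite expr0 -(mpolyC1 _ R); exact: (PC).
by rewrite exprS; apply: (PM) => //; exact: (PX).
Qed.

Lemma peval_rename k l (f : 'I_k -> 'I_l) (z : 'cV[R]_l) p :
  peval z (rename f p) = peval (\col_i z (f i) 0) p.
Proof.
rewrite /peval /rename comp_mpoly_meval; congr (meval _ p).
by apply/funext => i; rewrite tnth_mktuple mevalXU mxE.
Qed.

Lemma peval_embL k l (a : 'cV[R]_k) (b : 'cV[R]_l) p :
  peval (col_mx a b) (embL l p) = peval a p.
Proof.
by rewrite peval_rename; congr peval; apply/colP => i; rewrite mxE col_mxEu.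
Qed.

Lemma peval_embR k l (a : 'cV[R]_k) (b : 'cV[R]_l) p :
  peval (col_mx a b) (embR k p) = peval b p.
Proof.
by rewrite peval_rename; congr peval; apply/colP => i; rewrite mxE col_mxEd.
Qed.

Lemma mxeval_embL k l p q (a : 'cV[R]_k) (b : 'cV[R]_l) (M : 'M[mpoly k R]_(p, q)) :
  mxeval (col_mx a b) (map_mx (embL l) M) = mxeval a M.
Proof. by apply/matrixP => i j; rewrite !mxE peval_embL. Qed.

Lemma mxeval_rshift_vars k l (a : 'cV[R]_k) (b : 'cV[R]_l) :
  map_mx (peval (col_mx a b)) (\col_i pvar (rshift k i)) = b.
Proof. by apply/colP => i; rewrite !mxE peval_pvar col_mxEd. Qed.

Lemma mxeval_xvec k (x : 'cV[R]_k) : mxeval x xvec = x.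
Proof. by apply/colP => i; rewrite !mxE peval_pvar. Qed.

Lemma mderiv_rename0 k l (f : 'I_k -> 'I_l) i p :
  (forall a, f a != i) -> mderiv i (rename f p) = 0 :> mpoly l R.
Proof.
move=> fi; elim/mpoly_ring_ind: p => [c|a|p q Hp Hq|p q Hp Hq].
- by rewrite renameC mderivC.
- by rewrite rename_pvar /pvar mderivX mnm1E (negPf (fi a)) scale0r.
- by rewrite rmorphD /= mderivD Hp Hq addr0.
- by rewrite rmorphM /= mderivM Hp Hq mul0r mulr0 addr0.
Qed.

Lemma mderiv_pvar k (i j : 'I_k) : mderiv i (pvar j) = (j == i)%:R :> mpoly k R.
Proof.
rewrite /pvar mderivX mnm1E; case: eqP => [->|_]; last by rewrite scale0r.
have -> : mnm_sub (mnm1 i) (mnm1 i) = mnm0.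
  by apply/mnmP => a; rewrite mnmBE subnn mnm0E.
by rewrite mpolyX0 scale1r.
Qed.

Lemma has_deriv_within_peval k (D : set R) (z : R -> 'cV[R]_k) t (l : 'cV[R]_k) p :
  (forall i, has_deriv_within D (fun s => z s i 0) t (l i 0)) ->
  has_deriv_within D (fun s => peval (z s) p) t
    (\sum_i l i 0 * peval (z t) (mderiv i p)).
Proof.
move=> dz; elim/mpoly_ring_ind: p => [c|j|p q Hp Hq|p q Hp Hq].
- under eq_fun do rewrite pevalC.
  rewrite big1; first exact: has_deriv_within_cst.
  by move=> i _; rewrite mderivC rmorph0 mulr0.
- under eq_fun do rewrite peval_pvar.
  rewrite (bigD1 j) //= big1 ?addr0; last first.
    by move=> i ij; rewrite mderiv_pvar eq_sym (negPf ij) rmorph0 mulr0.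
  by rewrite mderiv_pvar eqxx rmorph_nat mulr1; exact: dz.
- under eq_fun do rewrite rmorphD /=.
  rewrite (_ : \sum_i _ = \sum_i l i 0 * peval (z t) (mderiv i p) +
      \sum_i l i 0 * peval (z t) (mderiv i q)); last first.
    rewrite -big_split; apply: eq_bigr => i _ /=.
    by rewrite mderivD rmorphD mulrDr.
  exact: has_deriv_withinD.
- under eq_fun do rewrite rmorphM /=.
  rewrite (_ : \sum_i _ =
      (\sum_i l i 0 * peval (z t) (mderiv i p)) * peval (z t) q +
      peval (z t) p * (\sum_i l i 0 * peval (z t) (mderiv i q))); last first.
    rewrite mulr_suml mulr_sumr -big_split; apply: eq_bigr => i _ /=.
    by rewrite mderivM rmorphD !rmorphM /=; ring.
  exact: has_deriv_withinM.
Qed.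

Lemma sos_ge0 k (z : 'cV[R]_k) p : is_sos p -> 0 <= peval z p.
Proof.
move=> [s ->]; rewrite rmorph_sum /=; apply: sumr_ge0 => q _.
by rewrite rmorphXn /= sqr_ge0.
Qed.

Lemma sos_multipliers_ge0 k (z : 'cV[R]_k) (I : finType) (lam g : I -> mpoly k R) :
  (forall i, is_sos (lam i)) -> (forall i, 0 <= peval z (g i)) ->
  0 <= peval z (\sum_i lam i * g i).
Proof.
move=> Hl Hg; rewrite rmorph_sum /=; apply: sumr_ge0 => i _.
by rewrite rmorphM /= mulr_ge0 // sos_ge0.
Qed.

Definition dotv k (u v : 'cV[R]_k) : R := (u^T *m v) 0 0.
Definition qval k (M : 'M[R]_k) (v : 'cV[R]_k) : R := (v^T *m M *m v) 0 0.

Lemma peval_qform k p (z : 'cV[R]_k) (M : 'M[mpoly k R]_p)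
    (v : 'cV[mpoly k R]_p) :
  peval z (qform M v) = qval (mxeval z M) (map_mx (peval z) v).
Proof.
have -> : peval z (qform M v) = mxeval z (v^T *m M *m v) 0 0 by rewrite mxE.
by rewrite !mxevalM mxeval_tr.
Qed.

Lemma dotvE k (u v : 'cV[R]_k) : dotv u v = \sum_i u i 0 * v i 0.
Proof. by rewrite /dotv mxE; apply: eq_bigr => i _; rewrite mxE. Qed.

Lemma dotv_ge0 k (v : 'cV[R]_k) : 0 <= dotv v v.
Proof. by rewrite dotvE; apply: sumr_ge0 => i _; rewrite -expr2 sqr_ge0. Qed.

Lemma dotv_eq0 k (v : 'cV[R]_k) : dotv v v <= 0 -> v = 0.
Proof.
move=> v0; apply/colP => i; rewrite mxE; apply/eqP; rewrite -sqrf_eq0.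
rewrite eq_le sqr_ge0 andbT (le_trans _ v0) // dotvE (bigD1 i) //= -expr2 lerDl.
by apply: sumr_ge0 => j _; rewrite -expr2 sqr_ge0.
Qed.

Lemma norm2_sqr k (v : 'cV[R]_k) : norm2 v ^+ 2 = dotv v v.
Proof.
rewrite /norm2 sqr_sqrtr; first by rewrite dotvE; apply: eq_bigr => i _; rewrite expr2.
by apply: sumr_ge0 => i _; rewrite sqr_ge0.
Qed.

Lemma qvalB k (M N : 'M[R]_k) v : qval (M - N) v = qval M v - qval N v.
Proof. by rewrite /qval mulmxBr mulmxBl !mxE. Qed.

Lemma qvalD k (M N : 'M[R]_k) v : qval (M + N) v = qval M v + qval N v.
Proof. by rewrite /qval mulmxDr mulmxDl !mxE. Qed.

Lemma qval_block_col k (K : 'rV[R]_k) (M : 'M[R]_k) (a : R) (w : 'cV[R]_k) :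
  qval (block_mx 1%:M K K^T M) (col_mx (a%:M : 'cV_1) w) =
    a ^+ 2 + 2 * a * (K *m w) 0 0 + qval M w.
Proof.
have D (P Q : 'M[R]_1) : (P + Q) 0 0 = P 0 0 + Q 0 0 by rewrite mxE.
have Z b (P : 'M[R]_1) : (b *: P) 0 0 = b * P 0 0 by rewrite mxE.
have S b : (b%:M : 'M[R]_1) 0 0 = b by rewrite mxE eqxx mulr1n.
rewrite {1}/qval -mulmxA mul_block_col tr_col_mx mul_row_col mul1mx tr_scalar_mx.
rewrite !mulmxDr !mul_scalar_mx !mul_mx_scalar -scalemxAr -trmx_mul !(D, Z) S.
rewrite mulmxA -/(qval M w) [(_^T) 0 0]mxE; ring.
Qed.

Lemma qval_tr k (M : 'M[R]_k) v : qval M^T v = qval M v.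
Proof.
rewrite /qval; have -> : v^T *m M^T *m v = (v^T *m M *m v)^T.
  by rewrite !trmx_mul trmxK mulmxA.
by rewrite mxE.
Qed.

Lemma qval_scalar k c (v : 'cV[R]_k) : qval c%:M v = c * dotv v v.
Proof. by rewrite /qval mul_mx_scalar -scalemxAl mxE. Qed.

Lemma qval_dotv k (M : 'M[R]_k) v : qval M v = dotv v (M *m v).
Proof. by rewrite /qval /dotv mulmxA. Qed.

Lemma dotvC k (u v : 'cV[R]_k) : dotv u v = dotv v u.
Proof. by rewrite !dotvE; apply: eq_bigr => i _; rewrite mulrC. Qed.

End PolynomialEvaluation.

(** * The SOS conditions as pointwise inequalities *)

Section EvaluatedConditions.
Context {R : realType} {n m nt Nt : nat}.
Variables (h : 'I_Nt -> mpoly nt R) (C : 'I_n -> 'rV[mpoly n R]_n).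

Lemma state_set_c_xt x (th : 'cV[R]_nt) j : state_set C x ->
  0 <= peval (col_mx x th) (c_xt C j).
Proof. by move=> Sx; rewrite peval_embL. Qed.

Lemma Theta_h_xt (x : 'cV[R]_n) (th : 'cV[R]_nt) i : Theta h th ->
  0 <= peval (col_mx x th) (h_xt h i).
Proof. by move=> Tth; rewrite peval_embR. Qed.

Lemma lmi_lower_eval (Xf : 'M[mpoly (n + nt) R]_n) eps lam mu :
  lmi_lower h C Xf eps lam mu ->
  (forall i, is_sos (lam i)) -> (forall j, is_sos (mu j)) ->
  forall x th v, state_set C x -> Theta h th ->
  eps * dotv v v <= qval (mxeval (col_mx x th) Xf) v.
Proof.
move=> /sos_ge0 H Hl Hm x th v Sx Tth; have {H} := H (col_mx (col_mx x th) v).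
rewrite !pevalB peval_qform mxeval_rshift_vars mxeval_embL.
rewrite mxevalB mxeval_scalar qvalB qval_scalar.
set a := peval _ _; set b := peval _ _.
have a0 : 0 <= a.
  by apply: sos_multipliers_ge0 => // i; rewrite peval_embL; exact: Theta_h_xt.
have b0 : 0 <= b.
  by apply: sos_multipliers_ge0 => // i; rewrite peval_embL; exact: state_set_c_xt.
lra.
Qed.

Lemma lmi_upper_eval (Xf : 'M[mpoly (n + nt) R]_n) eps lam mu :
  lmi_upper h C Xf eps lam mu ->
  (forall i, is_sos (lam i)) -> (forall j, is_sos (mu j)) ->
  forall x th v, state_set C x -> Theta h th ->
  qval (mxeval (col_mx x th) Xf) v <= eps * dotv v v.
Proof.
move=> /sos_ge0 H Hl Hm x th v Sx Tth; have {H} := H (col_mx (col_mx x th) v).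
rewrite !pevalB peval_qform mxeval_rshift_vars mxeval_embL.
rewrite mxevalB mxeval_scalar qvalB qval_scalar.
set a := peval _ _; set b := peval _ _.
have a0 : 0 <= a.
  by apply: sos_multipliers_ge0 => // i; rewrite peval_embL; exact: Theta_h_xt.
have b0 : 0 <= b.
  by apply: sos_multipliers_ge0 => // i; rewrite peval_embL; exact: state_set_c_xt.
lra.
Qed.

Lemma lmi_decrease_eval vlo vhi (F : 'M[mpoly (n + nt + nt) R]_n) eps lam mu xi :
  lmi_decrease h C vlo vhi F eps lam mu xi ->
  (forall i, is_sos (lam i)) -> (forall j, is_sos (mu j)) ->
  (forall k, is_sos (xi k)) ->
  forall x th d v, state_set C x -> Theta h th -> rectangle vlo vhi d ->
  qval (mxeval (col_mx (col_mx x th) d) F) v <= - eps * dotv v v.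
Proof.
move=> /sos_ge0 H Hl Hm Hxi x th d v Sx Tth Wd.
have {H} := H (col_mx (col_mx (col_mx x th) d) v).
rewrite !pevalB pevalN peval_qform mxeval_rshift_vars mxeval_embL.
rewrite mxevalD mxeval_scalar qvalD qval_scalar.
set a := peval _ _; set b := peval _ _; set c := peval _ _.
have a0 : 0 <= a.
  apply: sos_multipliers_ge0 => // i; rewrite 2!peval_embL; exact: Theta_h_xt.
have b0 : 0 <= b.
  apply: sos_multipliers_ge0 => // i; rewrite 2!peval_embL; exact: state_set_c_xt.
have c0 : 0 <= c.
  rewrite /c rmorph_sum /=; apply: sumr_ge0 => k _; rewrite !rmorphM /=.
  rewrite !pevalB !pevalC peval_pvar col_mxEu col_mxEd -mulrA.
  by have /andP[? ?] := Wd k; rewrite !mulr_ge0 ?sos_ge0 ?subr_ge0.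
lra.
Qed.

(** There is no multiplier of the [c_j] in this condition, so [x] is not restricted to the state
    set; this is what later allows membership in that set to be deduced. *)
Lemma lmi_inclusion_eval (Xf : 'M[mpoly (n + nt) R]_n) j alpha :
  lmi_inclusion h C Xf j alpha -> (forall i, is_sos (alpha i)) ->
  forall x th (a : R) w, Theta h th ->
  0 <= a ^+ 2 + 2 * a * (mxeval x (C j) *m mxeval (col_mx x th) Xf *m w) 0 0 +
    qval (mxeval (col_mx x th) Xf) w.
Proof.
move=> /sos_ge0 H Ha x th a w Tth.
have {H} := H (col_mx (col_mx x th) (col_mx (a%:M : 'cV_1) w)).
rewrite pevalB peval_qform mxeval_rshift_vars mxeval_embL.
set b := peval _ _.
have b0 : 0 <= b.
  by apply: sos_multipliers_ge0 => // i; rewrite peval_embL; exact: Theta_h_xt.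
have -> : mxeval (col_mx x th) (block_mx 1%:M (map_mx (embL nt) (C j) *m Xf)
    (map_mx (embL nt) (C j) *m Xf)^T Xf) =
    block_mx 1%:M (mxeval x (C j) *m mxeval (col_mx x th) Xf)
      (mxeval x (C j) *m mxeval (col_mx x th) Xf)^T (mxeval (col_mx x th) Xf).
  by rewrite /mxeval map_block_mx map_mx1 -!/(mxeval _ _) mxeval_tr mxevalM mxeval_embL.
rewrite qval_block_col; lra.
Qed.

Lemma peval_cpoly x j :
  peval x (cpoly C j) = 1 - ((mxeval x (C j) *m x) 0 0) ^+ 2.
Proof.
rewrite pevalB rmorph1; congr (_ - _).
have -> : peval x ((xvec^T *m (C j)^T *m C j *m xvec) 0 0) =
    mxeval x (xvec^T *m (C j)^T *m C j *m xvec) 0 0 by rewrite [RHS]mxE.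
rewrite !mxevalM !mxeval_tr mxeval_xvec -trmx_mul -mulmxA.
by rewrite mxE big_ord_recl big_ord0 addr0 mxE expr2.
Qed.

End EvaluatedConditions.

(** * The derivative of X along a trajectory *)

Section ClosedLoopAlgebra.
Context {R : realType} {n m nt : nat}.
Variables (A : 'M[mpoly (n + nt) R]_n) (B : 'M[mpoly (n + nt) R]_(n, m)).
Variables (X : 'M[mpoly (#|zero_rows B| + nt) R]_n).
Variable (Y : 'M[mpoly (n + nt) R]_(m, n)).

Lemma Xval_unreduce x th : Xval X x th = mxeval (col_mx x th) (unreduce X).
Proof.
apply/matrixP => i j; rewrite !mxE peval_rename; congr peval.
apply/colP => a; rewrite [RHS]mxE /reduced_index -[in LHS](splitK a).
by case: (fintype.split a) => b /=; rewrite ?col_mxEu ?col_mxEd ?mxE.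
Qed.

Lemma Xval_sym x th : X^T = X -> (Xval X x th)^T = Xval X x th.
Proof. by move=> hX; rewrite /Xval -mxeval_tr hX. Qed.

(** The derivative of [X] at the point [z] of (x, theta)-space along the velocity [l]. *)
Definition Xdir (z l : 'cV[R]_(n + nt)) : 'M[R]_n :=
  \matrix_(a, b) \sum_i l i 0 * peval z (mderiv i (unreduce X a b)).

(** The renaming reaches only the [theta] variables and the [x_j] with [j] in J. *)
Lemma mderiv_unreduce0 (j : 'I_n) a b :
  j \notin zero_rows B -> mderiv (lshift nt j) (unreduce X a b) = 0.
Proof.
move=> jJ; rewrite mxE; apply: mderiv_rename0 => c; rewrite /reduced_index.
case: fintype.split => d; apply/eqP => /(congr1 val) /=.
  move=> dj; move: jJ; have <- : enum_val d = j by apply/val_inj.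
  by rewrite enum_valP.
by move=> E; have := ltn_ord j; rewrite -E ltnNge leq_addr.
Qed.

Lemma closed_loop_zero_row x th j : j \in zero_rows B ->
  closed_loop A X Y x th j 0 = (mxeval (col_mx x th) A *m x) j 0.
Proof.
rewrite inE => /eqP Bj; rewrite /closed_loop mxE [X in _ + X]mxE big1 ?addr0 // => i _.
have -> : mxeval (col_mx x th) B j i = 0; last by rewrite mul0r.
by rewrite mxE; have /rowP/(_ i) := Bj; rewrite !mxE => ->; rewrite rmorph0.
Qed.

(** The sums subtracted in F_1 form the full derivative of [X] along [(xd, d)]: the state directions
    outside J contribute nothing, and on J the velocity agrees with A x. *)
Lemma mxeval_F1 (x : 'cV[R]_n) (th d : 'cV[R]_nt) (xd : 'cV[R]_n) :
  (forall j, j \in zero_rows B -> xd j 0 = (mxeval (col_mx x th) A *m x) j 0) ->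
  mxeval (col_mx (col_mx x th) d) (F1 A X Y) =
    let S := mxeval (col_mx x th) A *m Xval X x th +
             mxeval (col_mx x th) B *m mxeval (col_mx x th) Y in
    S + S^T - Xdir (col_mx x th) (col_mx xd d).
Proof.
move=> Hxd; rewrite /F1 /= mxevalB mxeval_embL mxevalB !mxevalD mxeval_tr !mxevalD !mxevalM.
rewrite -Xval_unreduce -addrA -opprD; congr (_ - _).
apply/matrixP => a b; rewrite mxE [RHS]mxE big_split_ord /=; congr (_ + _).
  rewrite mxE summxE rmorph_sum /= [RHS](bigID (mem (zero_rows B))) /=.
  rewrite [X in _ = _ + X]big1 ?addr0 => [|j jJ]; last first.
    by rewrite mderiv_unreduce0 // rmorph0 mulr0.
  apply: eq_bigr => j jJ; rewrite col_mxEu Hxd // mxE rmorphM /= [X in _ * peval _ X]mxE.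
  congr (_ * _).
  have -> : peval (col_mx x th) ((row j A *m map_mx (embL nt) xvec) 0 0) =
      mxeval (col_mx x th) (row j A *m map_mx (embL nt) xvec) 0 0 by rewrite [RHS]mxE.
  by rewrite mxevalM mxeval_embL mxeval_xvec /mxeval map_row -row_mul mxE.
rewrite mxE summxE rmorph_sum; apply: eq_bigr => k _ /=.
by rewrite mxE rmorphM /= peval_pvar !col_mxEd !mxE peval_embL.
Qed.

Lemma has_deriv_within_Xval D (x : R -> 'cV[R]_n) (th : R -> 'cV[R]_nt) t
    (xd : 'cV[R]_n) (d : 'cV[R]_nt) a b :
  (forall i, has_deriv_within D (fun s => x s i 0) t (xd i 0)) ->
  (forall i, has_deriv_within D (fun s => th s i 0) t (d i 0)) ->
  has_deriv_within D (fun s => Xval X (x s) (th s) a b) t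
    (Xdir (col_mx (x t) (th t)) (col_mx xd d) a b).
Proof.
move=> dx dth; rewrite mxE.
under eq_fun do rewrite Xval_unreduce mxE.
apply: has_deriv_within_peval => i; rewrite -[i]splitK.
case: (fintype.split i) => j /=.
  by rewrite col_mxEu; under eq_fun do rewrite col_mxEu; exact: dx.
by rewrite col_mxEd; under eq_fun do rewrite col_mxEd; exact: dth.
Qed.

End ClosedLoopAlgebra.

(** * Classes of functions closed under the ring operations *)

Section FunctionAlgebra.
Context {R : realType} (T : Type) (Q : (T -> R) -> Prop).
Hypothesis Q_cst : forall c : R, Q (fun=> c).
Hypothesis Q_add : forall f g, Q f -> Q g -> Q (fun s => f s + g s).
Hypothesis Q_mul : forall f g, Q f -> Q g -> Q (fun s => f s * g s).

Lemma fa_sum (I : Type) (r : seq I) (F : I -> T -> R) :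
  (forall i, Q (F i)) -> Q (fun s => \sum_(i <- r) F i s).
Proof.
move=> QF; elim: r => [|i r IH].
  by under eq_fun do rewrite big_nil; exact: Q_cst.
by under eq_fun do rewrite big_cons; exact: Q_add.
Qed.

Lemma fa_prod (I : Type) (r : seq I) (F : I -> T -> R) :
  (forall i, Q (F i)) -> Q (fun s => \prod_(i <- r) F i s).
Proof.
move=> QF; elim: r => [|i r IH].
  by under eq_fun do rewrite big_nil; exact: Q_cst.
by under eq_fun do rewrite big_cons; exact: Q_mul.
Qed.

(** Determinants and adjugates are polynomial in the entries, so they stay in any such class [Q];
    matrix inversion then costs a single division by the determinant. The class will be that of
    functions with the expected limit, or that of locally Lipschitz functions. *)
Lemma fa_det k (M : T -> 'M[R]_k) :
  (forall i j, Q (fun s => M s i j)) -> Q (fun s => \det (M s)).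
Proof.
move=> QM; apply: fa_sum => p; apply: Q_mul; first exact: Q_cst.
by apply: fa_prod => i; exact: QM.
Qed.

Lemma fa_adj k (M : T -> 'M[R]_k) :
  (forall i j, Q (fun s => M s i j)) -> forall i j, Q (fun s => (\adj (M s)) i j).
Proof.
move=> QM i j; under eq_fun do rewrite mxE; apply: Q_mul; first exact: Q_cst.
by apply: fa_det => a b; under eq_fun do rewrite !mxE; exact: QM.
Qed.

Lemma fa_mulmx p q r (M : T -> 'M[R]_(p, q)) (N : T -> 'M[R]_(q, r)) :
  (forall i j, Q (fun s => M s i j)) -> (forall i j, Q (fun s => N s i j)) ->
  forall i j, Q (fun s => (M s *m N s) i j).
Proof.
move=> QM QN i j; under eq_fun do rewrite mxE.
by apply: fa_sum => a; apply: Q_mul.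
Qed.

Lemma fa_scalemx p q (f : T -> R) (M : T -> 'M[R]_(p, q)) :
  Q f -> (forall i j, Q (fun s => M s i j)) ->
  forall i j, Q (fun s => (f s *: M s) i j).
Proof. by move=> Qf QM i j; under eq_fun do rewrite mxE; exact: Q_mul. Qed.

Lemma fa_peval k (z : T -> 'cV[R]_k) p :
  (forall i, Q (fun s => z s i 0)) -> Q (fun s => peval (z s) p).
Proof.
move=> Qz; elim/(@mpoly_ring_ind R k): p => [c|j|p q Hp Hq|p q Hp Hq].
- by under eq_fun do rewrite pevalC; exact: Q_cst.
- by under eq_fun do rewrite peval_pvar; exact: Qz.
- by under eq_fun do rewrite rmorphD /=; exact: Q_add.
- by under eq_fun do rewrite rmorphM /=; exact: Q_mul.
Qed.

Lemma fa_mxeval k p q (z : T -> 'cV[R]_k) (M : 'M[mpoly k R]_(p, q)) :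
  (forall i, Q (fun s => z s i 0)) -> forall i j, Q (fun s => mxeval (z s) M i j).
Proof. by move=> Qz i j; under eq_fun do rewrite mxE; exact: fa_peval. Qed.

Lemma fa_col_mx k l (x : T -> 'cV[R]_k) (y : T -> 'cV[R]_l) :
  (forall i, Q (fun s => x s i 0)) -> (forall i, Q (fun s => y s i 0)) ->
  forall i, Q (fun s => col_mx (x s) (y s) i 0).
Proof.
move=> Qx Qy i; rewrite -[i]splitK; case: (fintype.split i) => j /=.
  by under eq_fun do rewrite col_mxEu; exact: Qx.
by under eq_fun do rewrite col_mxEd; exact: Qy.
Qed.

End FunctionAlgebra.

(** * Limits of determinants and of inverse matrices *)

Section LimitsWithin.
Context {R : realType} (D : set R) (t : R).

Let lim_self (f : R -> R) := f s @[s --> within D t^'] --> f t.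

Let lim_cst c : lim_self (fun=> c). Proof. exact: cvg_cst. Qed.
Let lim_add f g : lim_self f -> lim_self g -> lim_self (fun s => f s + g s).
Proof. by move=> cf cg; exact: cvgD. Qed.
Let lim_mul f g : lim_self f -> lim_self g -> lim_self (fun s => f s * g s).
Proof. by move=> cf cg; exact: cvgM. Qed.

Lemma cvg_within_det k (M : R -> 'M[R]_k) :
  (forall i j, M s i j @[s --> within D t^'] --> M t i j) ->
  \det (M s) @[s --> within D t^'] --> \det (M t).
Proof. by move=> cM; apply: (fa_det lim_cst lim_add lim_mul). Qed.

Lemma near_within_unitmx k (M : R -> 'M[R]_k) :
  (forall i j, M s i j @[s --> within D t^'] --> M t i j) ->
  M t \in unitmx -> \forall s \near within D t^', M s \in unitmx.
Proof.
move=> cM; rewrite unitmxE unitfE => Mt.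
have H : \forall s \near within D t^', \det (M s) != 0.
  by apply: cvgr_neq0 Mt; exact: cvg_within_det.
apply: filterS H => s.
by rewrite unitmxE unitfE.
Qed.

Lemma cvg_within_invmx_mul k (M : R -> 'M[R]_k) (x : R -> 'cV[R]_k) :
  (forall i j, M s i j @[s --> within D t^'] --> M t i j) ->
  (forall i, x s i 0 @[s --> within D t^'] --> x t i 0) ->
  M t \in unitmx ->
  forall i, (invmx (M s) *m x s) i 0 @[s --> within D t^'] -->
            (invmx (M t) *m x t) i 0.
Proof.
move=> cM cx Mt i.
have E N : N \in unitmx -> forall y : 'cV[R]_k,
    (invmx N *m y) i 0 = (\det N)^-1 * (\adj N *m y) i 0.
  by move=> uN y; rewrite /invmx uN -scalemxAl mxE.
(* The adjugate formula fails on singular matrices, where [invmx] returns its argument, so it is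
   used only near [t], where the determinant stays nonzero. *)
rewrite E //; apply: (@cvg_trans _
    ((\det (M s))^-1 * (\adj (M s) *m x s) i 0 @[s --> within D t^'])).
  apply: near_eq_cvg; have := near_within_unitmx cM Mt; apply: filterS => s uM.
  by rewrite E.
apply: cvgM.
  by apply: cvgV; [rewrite -unitfE -unitmxE|exact: cvg_within_det].
apply: (fa_mulmx lim_cst lim_add lim_mul); last by move=> a b; rewrite (ord1 b); exact: cx.
exact: (fa_adj lim_cst lim_add lim_mul).
Qed.

Lemma cvg_within_sum (I : Type) (r : seq I) (F : I -> R -> R) (L : I -> R) :
  (forall i, F i s @[s --> within D t^'] --> L i) ->
  \sum_(i <- r) F i s @[s --> within D t^'] --> \sum_(i <- r) L i.
Proof.
move=> cF; elim: r => [|i r IH].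
  by under eq_fun do rewrite big_nil; rewrite big_nil; exact: cvg_cst.
by under eq_fun do rewrite big_cons; rewrite big_cons; exact: cvgD.
Qed.

End LimitsWithin.

(** * Locally Lipschitz functions of time and state *)

Section LocallyLipschitz.
Context {R : realType} {n : nat} (t0 : R).
Implicit Types (g : R * 'cV[R]_n -> R).

Lemma dist_max_le (a b c : R) : `|Num.max a c - Num.max b c| <= `|a - b|.
Proof.
have := ler_norm (a - b); have := ler_norm (- (a - b)); rewrite normrN !maxEle.
by case: (leP a c); case: (leP b c) => ? ? ? ?; rewrite ler_norml; apply/andP; split; lra.
Qed.

Lemma dist_min_le (a b c : R) : `|Num.min a c - Num.min b c| <= `|a - b|.
Proof.
have := ler_norm (a - b); have := ler_norm (- (a - b)); rewrite normrN !minEle.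
by case: (leP a c); case: (leP b c) => ? ? ? ?; rewrite ler_norml; apply/andP; split; lra.
Qed.

(** Continuity of the parameter is only available within the times from [t0] on, whereas the Picard
    iteration works with curves on the whole line; the value at [t0] is kept at earlier times. *)
Lemma continuous_extend_left (phi : R -> R) :
  (forall t, t0 <= t -> phi s @[s --> within (horizon t0 +oo%E) t^'] --> phi t) ->
  continuous (fun s => phi (Num.max s t0)).
Proof.
move=> cphi s; apply/cvgrPdist_lt => e e0.
have t0c : t0 <= Num.max s t0 by rewrite le_max lexx orbT.
move: (cphi _ t0c) => /cvgrPdist_lt /(_ e e0) /near_within_dnbhsP[d d0 Hd].
apply/nbhs_ballP; exists d => // u; rewrite /ball /= => su.
have [->|ne] := eqVneq (Num.max u t0) (Num.max s t0); first by rewrite subrr normr0.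
apply: Hd => //.
  by split; [rewrite le_max lexx orbT|rewrite ltry].
by apply: le_lt_trans su; rewrite distrC; exact: dist_max_le.
Qed.

(** A bound is packaged with the Lipschitz estimate so that the class is stable under products. Both
    are uniform in the state and local in time only. Continuity is stated along continuous curves,
    the form that the Picard iteration uses. *)
Definition loc_lipschitz g : Prop :=
  (forall u : R -> 'cV[R]_n, (forall i, continuous (fun s => u s i 0)) ->
     continuous (fun s => g (s, u s))) /\
  forall T, exists M L, [/\ 0 <= M, 0 <= L &
    forall s, t0 <= s -> s <= T -> forall (u v : 'cV[R]_n) e, 0 <= e ->
    (forall i, `|u i 0 - v i 0| <= e) ->
    `|g (s, u)| <= M /\ `|g (s, u) - g (s, v)| <= L * e].

Lemma loc_lipschitz_cst (c : R) : loc_lipschitz (fun=> c).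
Proof.
split=> [u cu s|T]; first exact: cvg_cst.
exists `|c|, 0; split => // s _ _ u v e e0 _.
by rewrite lexx subrr normr0 mul0r.
Qed.

Lemma loc_lipschitzD g1 g2 : loc_lipschitz g1 -> loc_lipschitz g2 ->
  loc_lipschitz (fun p => g1 p + g2 p).
Proof.
move=> [c1 H1] [c2 H2]; split=> [u cu s|T].
  by apply: cvgD; [exact: c1|exact: c2].
have [M1 [L1 [M10 L10 {}H1]]] := H1 T; have [M2 [L2 [M20 L20 {}H2]]] := H2 T.
exists (M1 + M2), (L1 + L2); split; [exact: addr_ge0|exact: addr_ge0|].
move=> s t0s sT u v e e0 uv.
have [B1 D1] := H1 s t0s sT u v e e0 uv; have [B2 D2] := H2 s t0s sT u v e e0 uv.
split; first by apply: le_trans (ler_normD _ _) _; exact: lerD.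
by rewrite opprD addrACA mulrDl; apply: le_trans (ler_normD _ _) _; exact: lerD.
Qed.

Lemma loc_lipschitzM g1 g2 : loc_lipschitz g1 -> loc_lipschitz g2 ->
  loc_lipschitz (fun p => g1 p * g2 p).
Proof.
move=> [c1 H1] [c2 H2]; split=> [u cu s|T].
  by apply: cvgM; [exact: c1|exact: c2].
have [M1 [L1 [M10 L10 {}H1]]] := H1 T; have [M2 [L2 [M20 L20 {}H2]]] := H2 T.
exists (M1 * M2), (M1 * L2 + L1 * M2); split.
- exact: mulr_ge0.
- by rewrite addr_ge0 // mulr_ge0.
move=> s t0s sT u v e e0 uv.
have [B1 D1] := H1 s t0s sT u v e e0 uv; have [B2 D2] := H2 s t0s sT u v e e0 uv.
(* The bound on [g2] at [v] comes from the estimate for the pair [v], [v] with [e = 0]. *)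
have vv i : `|v i 0 - v i 0| <= 0 by rewrite subrr normr0.
have [B2' _] := H2 s t0s sT v v 0 (lexx _) vv.
split; first by rewrite normrM ler_pM.
have -> : g1 (s, u) * g2 (s, u) - g1 (s, v) * g2 (s, v) =
  g1 (s, u) * (g2 (s, u) - g2 (s, v)) + (g1 (s, u) - g1 (s, v)) * g2 (s, v) by ring.
apply: le_trans (ler_normD _ _) _; rewrite !normrM mulrDl -mulrA [L1 * M2 * e]mulrAC.
by rewrite lerD // ler_pM.
Qed.

(** On the half-line from [d] on, inversion is bounded by 1/d and has Lipschitz constant 1/d^2. *)
Lemma loc_lipschitz_inv_max g (d : R) : 0 < d -> loc_lipschitz g ->
  loc_lipschitz (fun p => (Num.max (g p) d)^-1).
Proof.
move=> d0 [cg Hg]; have md a : d <= Num.max a d by rewrite le_max lexx orbT.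
have m0 a : 0 < Num.max a d by apply: lt_le_trans (md a).
split=> [u cu s|T].
  apply: cvgV; first by rewrite gt_eqF.
  by apply: (continuous_max (f := fun s => g (s, u s)) (g := fun=> d));
    [exact: cg|exact: cvg_cst].
have [M [L [M0 L0 {}Hg]]] := Hg T; exists d^-1, (L / d ^+ 2); split.
- by rewrite invr_ge0 ltW.
- by rewrite divr_ge0 // exprn_ge0 // ltW.
move=> s t0s sT u v e e0 uv; have [_ D] := Hg s t0s sT u v e e0 uv.
split; first by rewrite gtr0_norm ?invr_gt0 // lef_pV2 ?posrE.
set a := Num.max (g (s, u)) d; set b := Num.max (g (s, v)) d.
have ab : `|a - b| <= L * e.
  by apply: le_trans D; exact: dist_max_le.
have a0 : 0 < a := m0 _; have b0 : 0 < b := m0 _.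
have -> : a^-1 - b^-1 = (b - a) * (a^-1 * b^-1) by field; rewrite !gt_eqF.
rewrite normrM distrC [L / _ * e]mulrAC; apply: ler_pM => //.
rewrite ger0_norm ?mulr_ge0 ?invr_ge0 ?(ltW a0) ?(ltW b0) // expr2 invfM.
by apply: ler_pM; rewrite ?invr_ge0 ?(ltW a0) ?(ltW b0) // lef_pV2 ?posrE //; exact: md.
Qed.

Lemma loc_lipschitz_time (phi : R -> R) : continuous phi ->
  loc_lipschitz (fun p => phi p.1).
Proof.
move=> cphi; split=> [u cu|T]; first exact: cphi.
have [t0T|Tt0] := leP t0 T; last first.
  exists 0, 0; split => // s t0s sT.
  by have := lt_le_trans Tt0 (le_trans t0s sT); rewrite ltxx.
have cf : {within `[t0, T], continuous (fun t => `|phi t|)}.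
  by apply: continuous_subspaceT => s; apply: cvg_norm; exact: cphi.
have [c _ Hc] := EVT_max t0T cf.
exists `|phi c|, 0; split => // s t0s sT u v e e0 _ /=.
by rewrite subrr normr0 mul0r; split => //; apply: Hc; rewrite in_itv /= t0s.
Qed.

Definition clip (r a : R) : R := Num.max (- r) (Num.min a r).

Lemma clip_id r a : `|a| <= r -> clip r a = a.
Proof. by rewrite ler_norml => /andP[ra ar]; rewrite /clip min_l // max_r. Qed.

Lemma loc_lipschitz_clip (r : R) i : 0 <= r ->
  loc_lipschitz (fun p => clip r (p.2 i 0)).
Proof.
move=> r0; split=> [u cu s|T].
  apply: (continuous_max (f := fun=> - r) (g := fun s => Num.min (u s i 0) r)).
    exact: cvg_cst.
  by apply: (continuous_min (f := fun s => u s i 0) (g := fun=> r));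
    [exact: cu|exact: cvg_cst].
exists r, 1; split => // s _ _ u v e e0 uv /=; rewrite mul1r; split.
  by rewrite /clip ler_norml le_max lexx /= ge_max ge_min lexx orbT andbT ge0_cp.
apply: le_trans (uv i); rewrite /clip !(maxC (- r)).
by apply: le_trans (dist_max_le _ _ _) _; exact: dist_min_le.
Qed.

End LocallyLipschitz.

(** * Quadratic forms bounded below and their inverses *)

Section QuadraticForms.
Context {R : realType} {n : nat}.
Implicit Types (M : 'M[R]_n) (u v w x : 'cV[R]_n).

Lemma dotvDr u v w : dotv u (v + w) = dotv u v + dotv u w.
Proof. by rewrite /dotv mulmxDr mxE. Qed.

Lemma dotvZr u v (a : R) : dotv u (a *: v) = a * dotv u v.
Proof. by rewrite /dotv -scalemxAr mxE. Qed.

Lemma dotvDl u v w : dotv (v + w) u = dotv v u + dotv w u.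
Proof. by rewrite !(dotvC _ u) dotvDr. Qed.

Lemma dotvZl u v (a : R) : dotv (a *: v) u = a * dotv v u.
Proof. by rewrite !(dotvC _ u) dotvZr. Qed.

Lemma dotvBr u v w : dotv u (v - w) = dotv u v - dotv u w.
Proof. by rewrite /dotv mulmxBr !mxE. Qed.

Lemma dotvBl u v w : dotv (v - w) u = dotv v u - dotv w u.
Proof. by rewrite !(dotvC _ u) dotvBr. Qed.

Lemma dotv_trmx M u v : dotv u (M *m v) = dotv v (M^T *m u).
Proof. by rewrite [RHS]dotvC /dotv trmx_mul trmxK mulmxA. Qed.

Lemma qval_addZ M u v (a : R) : M^T = M ->
  qval M (u + a *: v) = qval M u + 2 * a * dotv v (M *m u) + a ^+ 2 * qval M v.
Proof.
move=> sM; rewrite !qval_dotv mulmxDr -scalemxAr.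
rewrite !(dotvDr, dotvZr, dotvDl, dotvZl) (dotv_trmx M u v) sM; ring.
Qed.

(** A finite-difference form of (M^-1)' = - M^-1 M' M^-1: the left-hand side is the increment of x^T
    M^-1 x, and on the right every term contains an increment of [x] or of [M], none of the
    inverse. *)
Lemma dotv_inverse_increment M (N : 'M[R]_n) u v x (y : 'cV[R]_n) :
  M^T = M -> M *m u = x -> N *m v = y ->
  dotv u x - dotv v y = dotv u (x - y) + dotv (x - y) v - dotv u ((M - N) *m v).
Proof.
move=> sM Mu Nv; rewrite mulmxBl Nv !(dotvBr, dotvBl) dotv_trmx sM Mu.
by rewrite (dotvC x v) (dotvC y v); ring.
Qed.

Lemma unitmx_of_qval_lower M (e : R) : 0 < e ->
  (forall v, e * dotv v v <= qval M v) -> M \in unitmx.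
Proof.
move=> e0 H; rewrite unitmxE unitfE; apply/negP => /det0P[v v0 vM].
have := H v^T; rewrite /qval trmxK vM mul0mx mxE pmulr_rle0 // => /dotv_eq0.
by move=> /(congr1 trmx); rewrite trmxK trmx0 => /eqP; rewrite (negPf v0).
Qed.

Lemma dotv_entry_le v i : (v i 0) ^+ 2 <= dotv v v.
Proof.
rewrite dotvE (bigD1 i) //= -expr2 lerDl.
by apply: sumr_ge0 => j _; rewrite -expr2 sqr_ge0.
Qed.

Lemma norm_entry_le v i : `|v i 0| <= norm2 v.
Proof.
rewrite -(@ler_pXn2r _ 2) ?nnegrE ?sqrtr_ge0 // real_normK ?num_real // norm2_sqr.
exact: dotv_entry_le.
Qed.

(** For [w] the [j]-th column of the inverse, w^T M w = w_j, so e |w|^2 <= w_j. As w_j^2 <= |w|^2,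
    this forces w_j <= 1/e, and then |w| <= 1/e. *)
Lemma invmx_entry_le M (e : R) : 0 < e ->
  (forall v, e * dotv v v <= qval M v) -> forall i j, `|invmx M i j| <= e^-1.
Proof.
move=> e0 H i j; have uM := unitmx_of_qval_lower e0 H.
pose w := col j (invmx M).
have Mw : M *m w = delta_mx j 0 by rewrite /w colE mulmxA mulmxV // mul1mx.
have qw : qval M w = w j 0.
  rewrite qval_dotv Mw dotvE (bigD1 j) //= big1 => [|k kj].
    by rewrite addr0 [delta_mx _ _ _ _]mxE !eqxx mulr1.
  by rewrite [delta_mx _ _ _ _]mxE (negPf kj) mulr0.
have hw := H w; rewrite qw in hw.
have hj := dotv_entry_le w j; have hi := dotv_entry_le w i.
have wj0 : 0 <= w j 0 by apply: le_trans hw; rewrite mulr_ge0 ?dotv_ge0 // ltW.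
have wj : w j 0 <= e^-1.
  rewrite -(ler_pM2l e0) divff ?gt_eqF //.
  have [->|nz] := eqVneq (w j 0) 0; first by rewrite mulr0.
  have wp : 0 < w j 0 by rewrite lt_neqAle eq_sym nz.
  by rewrite -(ler_pM2r wp) mul1r -mulrA -expr2; apply: le_trans hw; rewrite ler_pM2l.
have -> : invmx M i j = w i 0 by rewrite mxE.
rewrite -(@ler_pXn2r _ 2) ?nnegrE ?invr_ge0 ?(ltW e0) // real_normK ?num_real //.
apply: le_trans hi _; rewrite -(ler_pM2l e0) expr2 mulrA divff ?gt_eqF // mul1r.
exact: le_trans hw wj.
Qed.

Lemma det_norm_le M (c : R) : (forall i j, `|M i j| <= c) ->
  `|\det M| <= \sum_(s : {perm 'I_n}) \prod_(i < n) c.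
Proof.
move=> H; apply: le_trans (ler_norm_sum _ _ _) _; apply: ler_sum => s _.
rewrite normrM normrX normrN1 expr1n mul1r normr_prod.
by apply: ler_prod => i _; rewrite normr_ge0 H.
Qed.

(** By the Leibniz formula, the entry bound on the inverse bounds its determinant by n! e^-n;
    inverting bounds the determinant of [M] away from 0 without recourse to eigenvalues. The square
    spares a discussion of its sign. *)
Lemma det_sqr_lower_bound (e : R) : 0 < e -> exists2 d, 0 < d &
  forall M, (forall v, e * dotv v v <= qval M v) -> d <= \det M ^+ 2.
Proof.
move=> e0; pose K := 1 + \sum_(s : {perm 'I_n}) \prod_(i < n) e^-1.
have K0 : 0 < K.
  rewrite ltr_wpDr //; apply: sumr_ge0 => s _; apply: prodr_ge0 => i _.
  by rewrite invr_ge0 ltW.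
exists (K ^- 2); first by rewrite invr_gt0 exprn_gt0.
move=> M H; have uM := unitmx_of_qval_lower e0 H.
have := det_norm_le (invmx_entry_le e0 H); rewrite det_inv => HK.
have d0 : \det M != 0 by rewrite -unitfE -unitmxE.
have {}HK : `|\det M|^-1 <= K by rewrite -normfV; apply: le_trans HK _; rewrite lerDr.
rewrite -exprVn -[leRHS]real_normK ?num_real // ler_pXn2r ?nnegrE ?invr_ge0 ?(ltW K0) //.
by rewrite invf_ple ?posrE ?normr_gt0.
Qed.

End QuadraticForms.

(** * Lyapunov analysis of the closed loop *)

Section LyapunovAnalysis.
Context {R : realType} {n m nt Nt : nat}.
Variables (A : 'M[mpoly (n + nt) R]_n) (B : 'M[mpoly (n + nt) R]_(n, m)).
Variables (h : 'I_Nt -> mpoly nt R) (vlo vhi : 'cV[R]_nt).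
Variables (C : 'I_n -> 'rV[mpoly n R]_n).
Variables (X : 'M[mpoly (#|zero_rows B| + nt) R]_n).
Variables (Y : 'M[mpoly (n + nt) R]_(m, n)) (eps1 eps2 eps3 : R).

Let S := state_set C.
Let Th := Theta h.
Let W := rectangle vlo vhi.
Let f := closed_loop A X Y.
Let V := lyap X.
Let Om x th := Omega X Th 1 (x, th).

Hypothesis X_sym : X^T = X.
Hypotheses (eps1_gt0 : 0 < eps1) (eps2_gt0 : 0 < eps2) (eps3_gt0 : 0 < eps3).
Hypothesis X_lower : forall x th v, S x -> Th th ->
  eps1 * dotv v v <= qval (Xval X x th) v.
Hypothesis X_upper : forall x th v, S x -> Th th ->
  qval (Xval X x th) v <= eps2 * dotv v v.
Hypothesis F1_decrease : forall x th d v, S x -> Th th -> W d ->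
  qval (mxeval (col_mx (col_mx x th) d) (F1 A X Y)) v <= - eps3 * dotv v v.
Hypothesis X_inclusion : forall j x th (a : R) w, Th th ->
  0 <= a ^+ 2 + 2 * a * (mxeval x (C j) *m Xval X x th *m w) 0 0 +
       qval (Xval X x th) w.

Let w x th := invmx (Xval X x th) *m x.

Lemma Xval_unitmx x th : S x -> Th th -> Xval X x th \in unitmx.
Proof. by move=> Sx Tth; apply: (unitmx_of_qval_lower eps1_gt0) => v; exact: X_lower. Qed.

Lemma Xval_mul_w x th : Xval X x th \in unitmx -> Xval X x th *m w x th = x.
Proof. by move=> u; rewrite /w mulmxA mulmxV // mul1mx. Qed.

Lemma lyap_dotv x th : V x th = dotv (w x th) x.
Proof. by rewrite /V /lyap /dotv /w trmx_mul trmx_inv Xval_sym. Qed.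

Lemma lyap_qval x th : Xval X x th \in unitmx -> V x th = qval (Xval X x th) (w x th).
Proof. by move=> u; rewrite lyap_dotv qval_dotv Xval_mul_w. Qed.

(** Positivity of the form [X] at w - x / eps2 reads 0 <= V - 2 |x|^2 / eps2 + x^T X x / eps2^2, and
    the last term is at most |x|^2 / eps2. *)
Lemma lyap_lower x th : S x -> Th th -> dotv x x <= eps2 * V x th.
Proof.
move=> Sx Tth; have u := Xval_unitmx Sx Tth.
have h0 : 0 <= qval (Xval X x th) (w x th + (- eps2^-1) *: x).
  by apply: le_trans (X_lower _ Sx Tth); rewrite mulr_ge0 ?dotv_ge0 // ltW.
have h1 := X_upper x Sx Tth.
rewrite qval_addZ ?Xval_sym // Xval_mul_w // -lyap_qval // in h0.
have h2 : eps2^-1 * qval (Xval X x th) x <= dotv x x by rewrite ler_pdivrMl.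
have : 0 <= eps2 * (V x th + 2 * - eps2^-1 * dotv x x +
    (- eps2^-1) ^+ 2 * qval (Xval X x th) x) by rewrite mulr_ge0 // ltW.
have -> : eps2 * (V x th + 2 * - eps2^-1 * dotv x x +
    (- eps2^-1) ^+ 2 * qval (Xval X x th) x) =
    eps2 * V x th - 2 * dotv x x + eps2^-1 * qval (Xval X x th) x.
  by field; rewrite gt_eqF.
lra.
Qed.

(** Expand |x - eps1 w|^2 >= 0 and use eps1 |w|^2 <= w^T X w = V. *)
Lemma lyap_upper x th : S x -> Th th -> eps1 * V x th <= dotv x x.
Proof.
move=> Sx Tth; have u := Xval_unitmx Sx Tth.
have h0 := dotv_ge0 (x + (- eps1) *: w x th).
have h1 := X_lower (w x th) Sx Tth; rewrite -lyap_qval // in h1.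
have E : dotv (x + (- eps1) *: w x th) (x + (- eps1) *: w x th) =
    dotv x x - 2 * eps1 * V x th + eps1 * (eps1 * dotv (w x th) (w x th)).
  rewrite !(dotvDr, dotvZr, dotvDl, dotvZl) lyap_dotv.
  by rewrite (dotvC x (w x th)); ring.
rewrite E in h0.
have : eps1 * (eps1 * dotv (w x th) (w x th)) <= eps1 * V x th by rewrite ler_pM2l.
lra.
Qed.

Lemma lyap_le_w x th : S x -> Th th -> V x th <= eps2 * dotv (w x th) (w x th).
Proof. by move=> Sx Tth; rewrite lyap_qval ?Xval_unitmx //; exact: X_upper. Qed.

(* Take [a = - C_j(x) x] and [w = X^-1 x] in the inclusion inequality. *)
Lemma Omega_state_set x th : Om x th -> S x.
Proof.
move=> [/= u V1 Tth] j; rewrite peval_cpoly subr_ge0; apply: le_trans V1.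
have := X_inclusion j x (- (mxeval x (C j) *m x) 0 0) (w x th) Tth.
rewrite -mulmxA Xval_mul_w // -lyap_qval // -/V; set a := (_ *m _) 0 0.
have -> : (- a) ^+ 2 + 2 * - a * a = - a ^+ 2 by ring.
by rewrite addrC subr_ge0.
Qed.

Lemma has_deriv_within_lyap D (x : R -> 'cV[R]_n) (th : R -> 'cV[R]_nt) t
    (xd : 'cV[R]_n) (d : 'cV[R]_nt) :
  (forall i, has_deriv_within D (fun s => x s i 0) t (xd i 0)) ->
  (forall i, has_deriv_within D (fun s => th s i 0) t (d i 0)) ->
  Xval X (x t) (th t) \in unitmx ->
  has_deriv_within D (fun s => V (x s) (th s)) t
    (2 * dotv (w (x t) (th t)) xd -
     qval (Xdir X (col_mx (x t) (th t)) (col_mx xd d)) (w (x t) (th t))).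
Proof.
move=> dx dth u.
have dX a b : has_deriv_within D (fun s => Xval X (x s) (th s) a b) t
    (Xdir X (col_mx (x t) (th t)) (col_mx xd d) a b) by exact: has_deriv_within_Xval.
have cX a b := has_deriv_within_cvg (dX a b).
have cw := cvg_within_invmx_mul cX (fun i => has_deriv_within_cvg (dx i)) u.
pose ws s := w (x s) (th s).
(* The difference quotient of [V], rewritten by the exact increment formula; it agrees with the
   original one only where [X] is invertible, that is, near [t]. *)
pose q s := \sum_i ws s i 0 * ((x s i 0 - x t i 0) / (s - t)) +
  \sum_i (x s i 0 - x t i 0) / (s - t) * ws t i 0 -
  \sum_i \sum_j ws s i 0 * ((Xval X (x s) (th s) i j - Xval X (x t) (th t) i j) / (s - t)
    * ws t j 0).
have nu := near_within_unitmx cX u.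
rewrite /has_deriv_within; apply: (@cvg_trans _ (q s @[s --> within D t^'])).
  apply: near_eq_cvg; apply: filterS nu => s us.
  have E : V (x s) (th s) - V (x t) (th t) =
      dotv (ws s) (x s - x t) + dotv (x s - x t) (ws t) -
      dotv (ws s) ((Xval X (x s) (th s) - Xval X (x t) (th t)) *m ws t).
    rewrite !lyap_dotv; apply: dotv_inverse_increment.
    - exact: Xval_sym.
    - exact: Xval_mul_w.
    - exact: Xval_mul_w.
  rewrite E /q !dotvE mulrBl mulrDl !mulr_suml.
  congr (_ + _ - _); apply: eq_bigr => i _.
  - by rewrite !mxE mulrA.
  - by rewrite !mxE mulrAC.
  - rewrite [((_ - _) *m _) i 0]mxE mulr_sumr mulr_suml; apply: eq_bigr => j _.
    by rewrite !mxE -!mulrA; congr (_ * (_ * _)); rewrite mulrC.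
have -> : 2 * dotv (w (x t) (th t)) xd -
     qval (Xdir X (col_mx (x t) (th t)) (col_mx xd d)) (w (x t) (th t)) =
  \sum_i ws t i 0 * xd i 0 + \sum_i xd i 0 * ws t i 0 -
  \sum_i \sum_j ws t i 0 * (Xdir X (col_mx (x t) (th t)) (col_mx xd d) i j * ws t j 0).
  rewrite mulr2n mulrDl mul1r {2}dotvC !dotvE qval_dotv dotvE; congr (_ - _).
  by apply: eq_bigr => i _; rewrite [(Xdir _ _ _ *m _) _ _]mxE mulr_sumr.
apply: cvgB; first apply: cvgD.
- by apply: cvg_within_sum => i; apply: cvgM; [exact: cw|exact: dx].
- by apply: cvg_within_sum => i; apply: cvgM; [exact: dx|exact: cvg_cst].
- apply: cvg_within_sum => i; apply: cvg_within_sum => j; apply: cvgM; first exact: cw.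
  by apply: cvgM; [exact: dX|exact: cvg_cst].
Qed.

(** Since x = X w and u = Y w, the matrix A X + B Y sends [w] to the closed-loop velocity, and its
    symmetrisation produces the factor 2. *)
Lemma lyap_decrease x th d : S x -> Th th -> W d ->
  2 * dotv (w x th) (f x th) -
    qval (Xdir X (col_mx x th) (col_mx (f x th) d)) (w x th) <=
  - eps3 * dotv (w x th) (w x th).
Proof.
move=> Sx Tth Wd; have u := Xval_unitmx Sx Tth.
have := F1_decrease (w x th) Sx Tth Wd.
rewrite (@mxeval_F1 _ _ _ _ A B X Y x th d (f x th)) /=; last first.
  by move=> j; exact: closed_loop_zero_row.
rewrite qvalB qvalD qval_tr qval_dotv mulmxDl -!mulmxA Xval_mul_w //.
have -> : mxeval (col_mx x th) A *m x +
  mxeval (col_mx x th) B *m (mxeval (col_mx x th) Y *m w x th) = f x th.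
  by rewrite /f /closed_loop /controller /w -!mulmxA.
by rewrite -/(f x th) mulr2n mulrDl mul1r.
Qed.

(** The decay rate eps3 / eps2 arises here, from V = w^T X w <= eps2 |w|^2. *)
Lemma lyap_decrease_lyap x th d : S x -> Th th -> W d ->
  2 * dotv (w x th) (f x th) -
    qval (Xdir X (col_mx x th) (col_mx (f x th) d)) (w x th) <=
  - (eps3 / eps2 * V x th).
Proof.
move=> Sx Tth Wd; apply: le_trans (lyap_decrease Sx Tth Wd) _.
rewrite mulNr lerN2 -mulrA ler_pM2l // ler_pdivrMl //; exact: lyap_le_w.
Qed.

Lemma admissible_deriv th t0 T : admissible Th W th -> 0 <= t0 ->
  forall t, horizon t0 T t -> Th (th t) /\ exists2 d, W d &
    forall k, has_deriv_within (horizon t0 T) (fun s => th s k 0) t (d k 0).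
Proof.
move=> ath t00 t [t0t tT]; have [Tt [d Wd dth]] := ath t (le_trans t00 t0t).
split => //; exists d => // k; apply: has_deriv_withinW (dth k) => s [t0s _].
by split; [exact: le_trans t0s|rewrite ltry].
Qed.

(** * Trajectories that start in V <= 1 *)

Section Trajectory.
Variables (th : R -> 'cV[R]_nt) (t0 : R) (T : \bar R) (y : R -> 'cV[R]_n).
Hypotheses (ath : admissible Th W th) (t0_ge0 : 0 <= t0).
Let D := horizon t0 T.

(* [y] need not solve the closed loop outside Omega: this also covers the
   solutions of the modified vector field. *)
Hypothesis y_deriv : forall t, D t -> exists2 xd : 'cV[R]_n,
  (forall i, has_deriv_within D (fun s => y s i 0) t (xd i 0)) &
  (Om (y t) (th t) -> xd = f (y t) (th t)).

Hypothesis y_start : Om (y t0) (th t0).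

Lemma Omega_invariant t : D t -> Om (y t) (th t).
Proof.
move=> Dt; apply: (real_induction (t0 := t0) (t1 := t) (P := fun t => Om (y t) (th t))) => //.
- by case: Dt.
- move=> s t0s st Os; have Ds : D s by apply: (horizon_le Dt) => //; exact: ltW.
  have Ss := Omega_state_set Os.
  have [Ts [d Wd dth]] := admissible_deriv ath t0_ge0 Ds.
  have [xd dx /(_ Os) xdE] := y_deriv Ds.
  have us : Xval X (y s) (th s) \in unitmx by case: Os.
  have dV := has_deriv_within_lyap dx dth us; rewrite xdE in dV.
  have lV := lyap_decrease_lyap Ss Ts Wd.
  have cX a b : Xval X (y u) (th u) a b @[u --> within D s^'] --> Xval X (y s) (th s) a b.
    have dX : has_deriv_within D (fun u => Xval X (y u) (th u) a b) s
      (Xdir X (col_mx (y s) (th s)) (col_mx xd d) a b) by exact: has_deriv_within_Xval.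
    exact: has_deriv_within_cvg dX.
  have [e1 e10 H1] := near_within_dnbhsP (near_within_unitmx cX us).
  have [e2 e20 H2] : exists2 e, 0 < e & forall u, D u -> s < u -> u < s + e ->
      V (y u) (th u) <= 1.
    (* At V = 1 the slope is at most - eps3 / eps2 < 0, so [V] drops below 1 at once; where V < 1,
       continuity is enough. *)
    have [_ /= V1 _] := Os; move: V1; rewrite le_eqVlt => /orP[/eqP V1|V1].
      have l0 : - (eps3 / eps2 * V (y s) (th s)) < 0.
        by rewrite /V V1 mulr1 oppr_lt0 divr_gt0.
      have [e e0 He] := has_deriv_within_right_lt dV (le_lt_trans lV l0).
      exists e => // u Du su ue; have := He u Du su ue.
      by rewrite mul0r subr_lt0 /V V1 => /ltW.
    have [e e0 He] := cvg_within_lt (has_deriv_within_cvg dV) V1.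
    exists e => // u Du su ue; apply/ltW/He => //; first by rewrite gt_eqF.
    by rewrite gtr0_norm ?subr_gt0 // ltrBlDl.
  exists (Num.min e1 e2); first by rewrite lt_min e10.
  move=> u su ue ut.
  have Du : D u by apply: (horizon_le Dt) => //; exact/ltW/(le_lt_trans t0s).
  move: ue; rewrite -ltrBlDl lt_min => /andP[ue1 ue2].
  split => /=; last by case: (admissible_deriv ath t0_ge0 Du).
    by apply: H1 => //; [rewrite gt_eqF|rewrite gtr0_norm // subr_gt0].
  by apply: H2 => //; rewrite -ltrBlDl.
- move=> s t0s st Os; have Ds : D s by apply: (horizon_le Dt) => //; exact: ltW.
  have [Ts [d Wd dth]] := admissible_deriv ath t0_ge0 Ds.
  have [xd dx _] := y_deriv Ds.
  (* The [c_j] are treated before [V]: as polynomials they are continuous at [s] in any case, and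
     the resulting invertibility of [X] is what makes [V] continuous there. *)
  have Ss : S (y s).
    move=> j; apply: (left_limit_ge0 (t0 := t0) (T := T)
      (W := fun s => peval (y s) (cpoly C j))) => //.
      exact: (has_deriv_within_cvg (has_deriv_within_peval (p := cpoly C j) dx)).
    by move=> u t0u us; exact: (Omega_state_set (Os u t0u us)).
  have us := Xval_unitmx Ss Ts.
  split => //=; rewrite -subr_ge0.
  apply: (left_limit_ge0 (t0 := t0) (T := T) (W := fun s => 1 - V (y s) (th s))) => //.
    apply: cvgB; first exact: cvg_cst.
    exact: (has_deriv_within_cvg (has_deriv_within_lyap dx dth us)).
  by move=> u t0u ut; rewrite subr_ge0; case: (Os u t0u ut).
Qed.

Lemma lyap_decay t : D t ->
  V (y t) (th t) <= V (y t0) (th t0) * expR (- (eps3 / eps2 * (t - t0))).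
Proof.
move=> Dt; pose g := eps3 / eps2.
(* The integrating factor turns V' <= - g V into a nonincreasing product. *)
have H : V (y t) (th t) * expR (g * (t - t0)) <= V (y t0) (th t0) * expR (g * (t0 - t0)).
  apply: (nonincreasing_of_deriv (T := T)
    (W := fun s => V (y s) (th s) * expR (g * (s - t0)))) => //.
  move=> s Ds; have Os := Omega_invariant Ds; have Ss := Omega_state_set Os.
  have [Ts [d Wd dth]] := admissible_deriv ath t0_ge0 Ds.
  have [xd dx /(_ Os) xdE] := y_deriv Ds.
  have us : Xval X (y s) (th s) \in unitmx by case: Os.
  have dV := has_deriv_within_lyap dx dth us; rewrite xdE in dV.
  eexists; first by apply: (has_deriv_withinM dV); exact: has_deriv_within_expR.
  have lV := lyap_decrease_lyap Ss Ts Wd.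
  rewrite [X in _ + X]mulrA -mulrDl mulr_le0_ge0 ?expR_ge0 //.
  by rewrite addrC (mulrC _ g) -lerBrDl sub0r.
rewrite subrr mulr0 expR0 mulr1 in H.
by rewrite expRN ler_pdivlMr ?expR_gt0.
Qed.

Lemma norm_decay t : D t ->
  norm2 (y t) ^+ 2 <= eps2 * V (y t0) (th t0) * expR (- (eps3 / eps2 * (t - t0))).
Proof.
move=> Dt; have Ot := Omega_invariant Dt.
rewrite norm2_sqr; apply: le_trans (lyap_lower (th := th t) (Omega_state_set Ot) _) _.
  by case: Ot.
by rewrite -mulrA ler_pM2l //; exact: lyap_decay.
Qed.

End Trajectory.

(** Where V <= 1, x_i^2 <= |x|^2 <= eps2 V <= eps2; hence the clipping radius of the modified
    field. *)
Lemma clip_of_Omega x th i : Om x th -> `|x i 0| <= Num.sqrt eps2.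
Proof.
move=> Ox; have Tth : Th th by case: Ox.
rewrite -sqrtr_sqr; apply: ler_wsqrtr; apply: le_trans (dotv_entry_le x i) _.
apply: le_trans (lyap_lower (Omega_state_set Ox) Tth) _.
by rewrite ler_piMr ?(ltW eps2_gt0) //; case: Ox.
Qed.

Lemma closed_loop_global_solution th t0 x0 :
  admissible Th W th -> 0 <= t0 -> Om x0 (th t0) ->
  exists2 y, solution (cl_domain X) f th t0 +oo%E y & y t0 = x0.
Proof.
move=> ath t00 O0; pose r := Num.sqrt eps2.
have [del del0 Hdel] := @det_sqr_lower_bound R n eps1 eps1_gt0.
pose ths s := th (Num.max s t0).
(* The vector field is modified outside Omega, where [X] may be singular, so
   as to become globally Lipschitz: the state is clipped and the inverse of
   the determinant is regularised. *)
pose c (p : R * 'cV[R]_n) : 'cV[R]_n := \col_i clip r (p.2 i 0).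
pose z p := col_mx (c p) (ths p.1).
pose M p := Xval X (c p) (ths p.1).
(* The scalar det / max (det^2, del) equals 1 / det, whatever the sign of det, once det^2 >= del;
   the choice of [del] ensures this on Omega. *)
pose iX p := (\det (M p) * (Num.max (\det (M p) * \det (M p)) del)^-1) *: \adj (M p).
pose G p := mxeval (z p) A *m c p +
  mxeval (z p) B *m (mxeval (z p) Y *m iX p *m c p).
have Qc := @loc_lipschitz_cst R n t0.
have Qd := @loc_lipschitzD R n t0; have Qm := @loc_lipschitzM R n t0.
have LG i : loc_lipschitz t0 (fun p => G p i 0).
  have Lth k : loc_lipschitz t0 (fun p : R * 'cV[R]_n => ths p.1 k 0).
    apply: (@loc_lipschitz_time R n t0 (fun s => ths s k 0)).
    apply: (continuous_extend_left (phi := fun s => th s k 0)) => t t0t.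
    have Dt : horizon t0 +oo%E t by split => //; rewrite ltry.
    have [_ [d _ dth]] := admissible_deriv ath t00 Dt.
    exact: (has_deriv_within_cvg (dth k)).
  have Lc a b : loc_lipschitz t0 (fun p => c p a b).
    under eq_fun do rewrite mxE.
    by apply: loc_lipschitz_clip; exact: sqrtr_ge0.
  have Lz a : loc_lipschitz t0 (fun p => z p a 0) by apply: fa_col_mx.
  have LM a b : loc_lipschitz t0 (fun p => M p a b).
    by under eq_fun do rewrite /M Xval_unreduce; exact: (fa_mxeval Qc Qd Qm).
  have Ldet : loc_lipschitz t0 (fun p => \det (M p)) by exact: (fa_det Qc Qd Qm).
  have LiX a b : loc_lipschitz t0 (fun p => iX p a b).
    apply: (fa_scalemx Qm); last exact: (fa_adj Qc Qd Qm).
    by apply: (Qm) => //; apply: loc_lipschitz_inv_max => //; exact: (Qm).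
  have Lmul p q s (U : R * 'cV[R]_n -> 'M[R]_(p, q)) (U' : R * 'cV[R]_n -> 'M[R]_(q, s)) :
      (forall a b, loc_lipschitz t0 (fun p => U p a b)) ->
      (forall a b, loc_lipschitz t0 (fun p => U' p a b)) ->
      forall a b, loc_lipschitz t0 (fun p => (U p *m U' p) a b).
    exact: (fa_mulmx Qc Qd Qm).
  under eq_fun do rewrite mxE; apply: (Qd).
    by apply: (Lmul) => //; exact: (fa_mxeval Qc Qd Qm).
  apply: (Lmul); first exact: (fa_mxeval Qc Qd Qm).
  apply: (Lmul) => //; apply: (Lmul) => //; exact: (fa_mxeval Qc Qd Qm).
have GE t x : t0 <= t -> Om x (th t) -> G (t, x) = f x (th t).
  move=> t0t Ox; have Tth : Th (th t) by case: Ox.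
  have thE : ths t = th t by rewrite /ths max_l.
  have cE : c (t, x) = x.
    by apply/colP => i; rewrite mxE clip_id //; exact: clip_of_Omega Ox.
  have Sx := Omega_state_set Ox; have u := Xval_unitmx Sx Tth.
  have iXE : iX (t, x) = invmx (Xval X x (th t)).
    rewrite /iX /M cE thE /invmx u max_l; last first.
      by rewrite -expr2; apply: Hdel => v; exact: X_lower.
    by rewrite invfM mulrA divff ?mul1r // -unitfE -unitmxE.
  by rewrite /G iXE /z cE thE.
have [||y y0 dy] := @lipschitz_ode_global_solution R n t0 (fun s u => G (s, u)) x0.
- by move=> u cu i; exact: (LG i).1 u cu.
- move=> T; have [L L0 HL] : exists2 L, 0 <= L & forall i, forall s, t0 <= s -> s <= T ->
      forall (u v : 'cV[R]_n) e, 0 <= e -> (forall j, `|u j 0 - v j 0| <= e) ->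
      `|G (s, u) i 0 - G (s, v) i 0| <= L * e.
    apply: finite_uniform_bound => [i a b ab H s t0s sT u v e e0 uv|i].
      by apply: le_trans (H s t0s sT u v e e0 uv) _; exact: ler_wpM2r.
    have [K [L [_ _ H]]] := (LG i).2 T; exists L => s t0s sT u v e e0 uv.
    by case: (H s t0s sT u v e e0 uv).
  exists (L + 1); first exact: ltr_wpDl.
  move=> s t0s sT u v e e0 uv i; apply: le_trans (HL i s t0s sT u v e e0 uv) _.
  by rewrite ler_wpM2r // lerDl.
exists y => // t Dt; have t0t : t0 <= t by case: Dt.
have Ot : Om (y t) (th t).
  apply: (Omega_invariant ath t00 (T := +oo%E)) => //; last by rewrite y0.
  move=> s [t0s _]; exists (G (s, y s)); first exact: dy.
  exact: GE.
by split; [case: Ot|move=> i; rewrite -GE //; exact: dy].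
Qed.

Lemma solution_deriv th t0 T y : solution (cl_domain X) f th t0 T y ->
  forall t, horizon t0 T t -> exists2 xd : 'cV[R]_n,
    (forall i, has_deriv_within (horizon t0 T) (fun s => y s i 0) t (xd i 0)) &
    (Om (y t) (th t) -> xd = f (y t) (th t)).
Proof. by move=> sol t Dt; exists (f (y t) (th t)) => //; case: (sol t Dt). Qed.

Lemma state_set_near0 : exists2 c, 0 < c & forall x, norm2 x < c -> S x.
Proof.
(* The filter of Euclidean balls around 0: closure of limits under the ring operations then yields
   the radius directly in terms of [norm2]. *)
pose F := filter_from [set e : R | 0 < e] (fun e => [set x : 'cV[R]_n | norm2 x < e]).
have FF : Filter F.
  apply: filter_from_filter; first by exists 1 => /=.
  move=> a b /= a0 b0; exists (Num.min a b); first by rewrite /= lt_min a0.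
  by move=> x; rewrite /= lt_min => /andP[].
have cp j : peval x (cpoly C j) @[x --> F] --> peval 0 (cpoly C j).
  apply: (@fa_peval R _ (fun g => g x @[x --> F] --> g (0 : 'cV[R]_n)) _ _ _ n id).
  - by move=> k; exact: cvg_cst.
  - by move=> g1 g2 H1 H2; exact: cvgD.
  - by move=> g1 g2 H1 H2; exact: cvgM.
  - move=> i; apply/cvgrPdist_lt => e e0; exists e => // x xe.
    rewrite [X in `|X - _|]mxE sub0r normrN; apply: le_lt_trans xe.
    exact: norm_entry_le.
(* Each c_j equals 1 at the origin, and there are finitely many of them. *)
have : \forall x \near F, forall j, 0 < peval x (cpoly C j).
  apply: filter_forall => j; apply: (cvgr_gt _ (cp j)).
  by rewrite peval_cpoly mulmx0 mxE expr0n /= subr0.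
by move=> [e e0 He]; exists e => // x xe j; apply/ltW/He.
Qed.

Lemma closed_loop_exponentially_stable : exponentially_stable Th W (cl_domain X) f.
Proof.
have [c0 c00 Hc0] := state_set_near0.
(* The decay estimate concerns |x|^2, hence the square root of eps2 / eps1 and the halved rate. The
   radius [c0] puts x0 in the state set, and |x0|^2 <= eps1 then gives V <= 1 because eps1 V <=
   |x0|^2. *)
exists (Num.sqrt (eps2 / eps1)), (eps3 / eps2 / 2), (Num.min c0 (Num.sqrt eps1)).
split; rewrite ?sqrtr_gt0 ?divr_gt0 //; first by rewrite lt_min c00 sqrtr_gt0.
move=> th ath t0 t00 x0; rewrite lt_min => /andP[xc0 xe1].
have [Tth _] := ath t0 t00; have Sx0 := Hc0 _ xc0.
have hV := lyap_upper Sx0 Tth.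
have O0 : Om x0 (th t0).
  split => //=; first exact: Xval_unitmx.
  rewrite -(ler_pM2l eps1_gt0) mulr1; apply: le_trans hV _; rewrite -norm2_sqr.
  rewrite -[leRHS]sqr_sqrtr ?(ltW eps1_gt0) // ler_pXn2r ?nnegrE ?sqrtr_ge0 //.
  exact: ltW.
split; first exact: closed_loop_global_solution.
move=> T y sol y0 t Dt; rewrite y0.
have := norm_decay ath t00 (solution_deriv sol); rewrite y0 => /(_ O0 t Dt) H.
have n0 : 0 <= norm2 x0 by exact: sqrtr_ge0.
rewrite -(@ler_pXn2r _ 2) ?nnegrE ?sqrtr_ge0 ?mulr_ge0 ?sqrtr_ge0 ?expR_ge0 //.
apply: le_trans H _.
rewrite !exprMn sqr_sqrtr ?divr_ge0 ?(ltW eps1_gt0) ?(ltW eps2_gt0) //.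
rewrite [expR _ ^+ 2]expr2 -expRD -opprD -mulrDl -splitr norm2_sqr.
rewrite ler_wpM2r ?expR_ge0 // -mulrA ler_pM2l // ler_pdivlMl //.
Qed.

Lemma closed_loop_lyapunov_certificate :
  lyapunov_certificate Th W (cl_domain X) f S V.
Proof.
(* The last constant combines V' <= - (eps3 / eps2) V with V >= |x|^2 / eps2. *)
exists eps2^-1, eps1^-1, (eps3 / eps2 ^+ 2).
split; rewrite ?invr_gt0 ?divr_gt0 ?exprn_gt0 //.
  move=> x th Sx Tth; split; first exact: Xval_unitmx.
  rewrite norm2_sqr ler_pdivrMl // ler_pdivlMl // lyap_lower //=; exact: lyap_upper.
move=> th ath t0 t00 T y sol t Dt St.
have [Tth [d Wd dth]] := admissible_deriv ath t00 Dt.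
have [_ dy] := sol t Dt.
eexists; first exact: (has_deriv_within_lyap dy dth (Xval_unitmx St Tth)).
apply: le_trans (lyap_decrease_lyap St Tth Wd) _.
rewrite mulNr lerN2 norm2_sqr -!mulrA ler_pM2l //.
rewrite expr2 invfM -mulrA ler_pM2l ?invr_gt0 // ler_pdivrMl //; exact: lyap_lower.
Qed.

Lemma Omega_region_of_attraction :
  Omega X Th 1 `<=` region_of_attraction Th W (cl_domain X) f.
Proof.
move=> [x0 th0] O0 th ath /= th0E.
have {}O0 : Om x0 (th 0) by rewrite th0E.
split; first exact: closed_loop_global_solution.
move=> y sol y0; pose g := eps3 / eps2; have g0 : 0 < g by rewrite divr_gt0.
have H t : 0 <= t -> norm2 (y t) ^+ 2 <= eps2 * expR (- (g * t)).
  move=> t0; have Dt : horizon 0 +oo%E t by split => //; rewrite ltry.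
  have := norm_decay ath (lexx 0) (solution_deriv sol); rewrite y0 => /(_ O0 t Dt).
  rewrite subr0 => /le_trans; apply; rewrite ler_wpM2r ?expR_ge0 //.
  by rewrite ler_piMr ?(ltW eps2_gt0) //; case: O0.
have e2 : 0 < eps2 by [].
apply/cvg_ballP => e e0; near=> t.
have t0 : 0 <= t by near: t; exact: nbhs_pinfty_ge.
split => // i j; rewrite /ball /= mxE sub0r normrN (ord1 j).
rewrite -(@ltr_pXn2r _ 2) ?nnegrE ?(ltW e0) // real_normK ?num_real //.
apply: le_lt_trans (dotv_entry_le (y t) i) _; rewrite -norm2_sqr.
apply: le_lt_trans (H t t0) _; rewrite expRN ltr_pdivrMr ?expR_gt0 //.
have e20 : 0 < e ^+ 2 by rewrite exprn_gt0.
(* The inequality [1 + x <= expR x] is enough for the limit: it remains to have g t > eps2 / e^2. *)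
rewrite mulrC -ltr_pdivrMr //; apply: lt_le_trans (expR_ge1Dx _).
apply: (@lt_trans _ _ (g * t)); last by rewrite ltrDr.
rewrite -ltr_pdivrMl //; near: t; apply: nbhs_pinfty_gt; exact: num_real.
Unshelve. all: by end_near. Qed.

End LyapunovAnalysis.

Theorem theorem1 (R : realType) (n m nt Nt : nat)
    (A : 'M[mpoly (n + nt) R]_n) (B : 'M[mpoly (n + nt) R]_(n, m))
    (h : 'I_Nt -> mpoly nt R) (vlo vhi : 'cV[R]_nt)
    (C : 'I_n -> 'rV[mpoly n R]_n)
    (X : 'M[mpoly (#|zero_rows B| + nt) R]_n)
    (Y : 'M[mpoly (n + nt) R]_(m, n))
    (eps1 eps2 eps3 : R)
    (lam1 lam2 : 'I_Nt -> mpoly (n + nt + n) R)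
    (lam3 : 'I_Nt -> mpoly (n + nt + nt + n) R)
    (alpha : 'I_n -> 'I_Nt -> mpoly (n + nt + (1 + n)) R)
    (mu1 mu2 : 'I_n -> mpoly (n + nt + n) R)
    (mu3 : 'I_n -> mpoly (n + nt + nt + n) R)
    (xi : 'I_nt -> mpoly (n + nt + nt + n) R)
    (hX : X^T = X)
    (heps1 : 0 < eps1) (heps2 : 0 < eps2) (heps3 : 0 < eps3)
    (hlam1 : forall i, is_sos (lam1 i)) (hlam2 : forall i, is_sos (lam2 i))
    (hlam3 : forall i, is_sos (lam3 i))
    (halpha : forall j i, is_sos (alpha j i))
    (hmu1 : forall j, is_sos (mu1 j)) (hmu2 : forall j, is_sos (mu2 j))
    (hmu3 : forall j, is_sos (mu3 j))
    (hxi : forall k, is_sos (xi k))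
    (hlower : lmi_lower h C (unreduce X) eps1 lam1 mu1)
    (hupper : lmi_upper h C (unreduce X) eps2 lam2 mu2)
    (hdecrease : lmi_decrease h C vlo vhi (F1 A X Y) eps3 lam3 mu3 xi)
    (hinclusion : forall j, lmi_inclusion h C (unreduce X) j (alpha j)) :
  [/\ exponentially_stable (Theta h) (rectangle vlo vhi)
        (cl_domain X) (closed_loop A X Y),
      lyapunov_certificate (Theta h) (rectangle vlo vhi)
        (cl_domain X) (closed_loop A X Y) (state_set C) (lyap X)
    & Omega X (Theta h) 1 `<=`
        region_of_attraction (Theta h) (rectangle vlo vhi)
          (cl_domain X) (closed_loop A X Y)].
Proof.
(* The Lyapunov analysis uses the SOS certificates only through the four pointwise inequalities that
   follow. *)
have X_lower x th v : state_set C x -> Theta h th ->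
    eps1 * dotv v v <= qval (Xval X x th) v.
  by move=> Sx Tth; rewrite Xval_unreduce; exact: (lmi_lower_eval hlower).
have X_upper x th v : state_set C x -> Theta h th ->
    qval (Xval X x th) v <= eps2 * dotv v v.
  by move=> Sx Tth; rewrite Xval_unreduce; exact: (lmi_upper_eval hupper).
have F1_decrease x th d v : state_set C x -> Theta h th -> rectangle vlo vhi d ->
    qval (mxeval (col_mx (col_mx x th) d) (F1 A X Y)) v <= - eps3 * dotv v v.
  exact: (lmi_decrease_eval hdecrease).
have X_inclusion j x th (a : R) w : Theta h th ->
    0 <= a ^+ 2 + 2 * a * (mxeval x (C j) *m Xval X x th *m w) 0 0 +
      qval (Xval X x th) w.
  by rewrite Xval_unreduce; exact: (lmi_inclusion_eval (hinclusion j)).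
split.
- exact: (closed_loop_exponentially_stable hX heps1 heps2 heps3 X_lower X_upper
    F1_decrease X_inclusion).
- exact: (closed_loop_lyapunov_certificate hX heps1 heps2 heps3 X_lower X_upper
    F1_decrease).
- exact: (Omega_region_of_attraction hX heps1 heps2 heps3 X_lower X_upper
    F1_decrease X_inclusion).
Qed.
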